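(* Let $q\in[1,+\infty)$ and assume that: (a) there exists an integer $m_0\ge1$ such that $\mathbb{E}\left[\min_{1\le j\le m_0}|X'_j|\right]<+\infty$; (b) there exists an open set $U\subset\mathbb{R}^d$ containing $\operatorname{supp}(\mu_X)$ such that: (i) the measure $\mu_{X'}(\cdot\cap U)$ has a density $p_{X'}$ with respect to the Lebesgue measure; (ii) $p_{X'}$ is continuous and positive on $U$; (iii) there exist $\kappa\in(0,1]$ and $r_\kappa>0$ such that for any $x\in U$ and any $r\in[0,r_\kappa]$, $\mu_{X'}(B(x,r))\ge\kappa\,p_{X'}(x)\,v_d\,r^d$; (c) with $X\sim\mu_X$, $\mathbb{E}\left[\dfrac{1+|X|^q}{p_{X'}(X)^{q/d}}\right]<+\infty$. Then, for every $n\ge1$, $$\lim_{m\to+\infty}m^{q/d}\,\mathbb{E}\left[W_q^q\left(\hat{\mu}_{\mathbf{X}_n},\hat{\mu}_{\mathbf{X}'_m}^{(1)}\right)\right]=\frac{\Gamma(1+q/d)}{v_d^{q/d}}\,\mathbb{E}\left[\frac{1}{p_{X'}(X)^{q/d}}\right].$$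
   Context: $|\cdot|$ is a fixed norm on $\mathbb{R}^d$ (not necessarily Euclidean), $B(x,r)=\{x':|x-x'|\le r\}$, $v_d$ is the Lebesgue volume of the unit ball of $|\cdot|$, and $\Gamma$ is Euler's Gamma function. $\mu_X,\mu_{X'}$ are probability measures on $\mathbb{R}^d$. $(X_i)_{i\ge1}$ are i.i.d. with law $\mu_X$, $(X'_j)_{j\ge1}$ are i.i.d. with law $\mu_{X'}$, and the two samples are independent; $\mathbf{X}_n=(X_1,\dots,X_n)$, $\mathbf{X}'_m=(X'_1,\dots,X'_m)$. $\operatorname{supp}(\nu)=\{x\in\mathbb{R}^d:\forall r>0,\ \nu(B(x,r))>0\}$. $W_q(\mu,\nu)=\inf\{\int|x-x'|^q\,d\gamma(x,x'):\gamma\in\Pi(\mu,\nu)\}^{1/q}$, where $\Pi(\mu,\nu)$ is the set of couplings of $\mu$ and $\nu$. For $x\in\mathbb{R}^d$, $j^{(1)}(x)$ is the lowest index $j\in\{1,\dots,m\}$ minimizing $|x-X'_j|$. Set $\hat{\mu}_{\mathbf{X}_n}:=\frac1n\sum_{i=1}^n\delta_{X_i}$ and $$\hat{\mu}_{\mathbf{X}'_m}^{(1)}:=\frac1m\sum_{j=1}^m w^{(1)}_j\delta_{X'_j},\qquad w^{(1)}_j:=\frac{m}{n}\sum_{i=1}^n\mathbf{1}_{\{j=j^{(1)}(X_i)\}}.$$ *)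

(* Defs.v *)
From HB Require Import structures.
From mathcomp Require Import all_boot all_order all_algebra.
From mathcomp Require Import all_classical all_reals all_analysis.
From mathcomp Require Import measurable_realfun.

Set Implicit Arguments.
Unset Strict Implicit.
Unset Printing Implicit Defensive.

Import Order.TTheory GRing.Theory Num.Theory.
Import numFieldNormedType.Exports.

Local Open Scope classical_set_scope.
Local Open Scope ring_scope.

(* Open sets are those of the library's (sup-norm) topology on matrices; in
   finite dimension this is the topology of every norm. *)
HB.instance Definition _ (R : realType) (m n : nat) :=
  @isMeasurable.Build (sigma_display (@open 'M[R]_(m, n))) 'M[R]_(m, n)
    <<s (@open 'M[R]_(m, n)) >>
    (@sigma_algebra0 _ setT (@open 'M[R]_(m, n)))
    (@sigma_algebraC 'M[R]_(m, n) (@open 'M[R]_(m, n)))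
    (@sigma_algebra_bigcup _ setT (@open 'M[R]_(m, n))).

Section borel_rV.
Context {R : realType}.

Lemma open_measurable_rV n (A : set 'rV[R]_n) : open A -> measurable A.
Proof. exact: sub_sigma_algebra. Qed.

Lemma continuous_measurable_rV n (f : 'rV[R]_n -> R) :
  continuous f -> measurable_fun setT f.
Proof.
move=> /continuousP cf; apply: (measurability _ (RGenOpens.measurableE R)).
move=> _ [_ [a [b ->] <-]]; rewrite setTI.
by apply: open_measurable_rV; apply: cf; exact: interval_open.
Qed.

Lemma measurable_coord n (j : 'I_n) :
  measurable_fun setT (fun v : 'rV[R]_n => v ord0 j).
Proof. by apply: continuous_measurable_rV; exact: coord_continuous. Qed.

Let rat_box n (cr : 'rV[rat]_n * rat) : set 'rV[R]_n :=
  [set v | forall j, ball (ratr (cr.1 ord0 j) : R) (ratr cr.2) (v ord0 j)].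

Lemma open_bigcup_rat_box n (A : set 'rV[R]_n) : open A ->
  A = \bigcup_(cr : 'rV[rat]_n * rat)
        (if `[< 0 < cr.2 /\ rat_box cr `<=` A >] then rat_box cr else set0).
Proof.
move=> oA; apply/seteqP; split=> [v Av|v [cr _]]; last first.
  by case: asboolP => // -[_]; apply.
have /nbhs_ballP[e /= e0 eA] : nbhs v A by exact: open_nbhs_nbhs.
have [r] := @rat_in_itvoo R 0 (e / 2) (divr_gt0 e0 (ltr0n _ 2)).
rewrite in_itv/= => /andP[r0 re].
have /choice[c cP] : forall j : 'I_n, exists c : rat,
    ball (v ord0 j) (ratr r) (ratr c).
  move=> j; have [|c] := @rat_in_itvoo R (v ord0 j) (v ord0 j + ratr r).
    by rewrite ltrDl.
  rewrite in_itv/= => /andP[vc cv]; exists c.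
  by rewrite /ball/= distrC ger0_norm ?subr_ge0 ?(ltW vc)// ltrBlDl.
exists (\row_j c j, r) => //=; rewrite asboolT.
  by move=> j; rewrite mxE; exact: ball_sym.
split; first by rewrite -(ltr0q R).
move=> w wb; apply: eA; split=> // i j; rewrite !ord1.
apply: (@le_ball _ _ _ (ratr r + ratr r)).
  by rewrite (splitr e) lerD// ltW.
by apply: (ball_triangle (cP j)); move: (wb j); rewrite mxE.
Qed.

Lemma measurable_fun_rV d (T : measurableType d) n (f : T -> 'rV[R]_n) :
  (forall j, measurable_fun setT (fun t => f t ord0 j)) -> measurable_fun setT f.
Proof.
move=> mf; apply: (@measurability _ _ _ _ setT f (@open 'rV[R]_n)) => //.
move=> _ [A oA <-]; rewrite setTI (open_bigcup_rat_box oA) preimage_bigcup.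
apply: countable_bigcupT_measurable => // cr.
case: asboolP => _; last by rewrite preimage_set0.
rewrite (_ : _ @^-1` _ = \bigcap_(j in [set: 'I_n])
  ((fun t => f t ord0 j) @^-1` ball (ratr (cr.1 ord0 j) : R) (ratr cr.2))).
  apply: fin_bigcap_measurable => // j _; rewrite -[X in measurable X]setTI.
  by apply: mf => //; exact: measurable_ball.
by apply/seteqP; split=> t /= tb j => [_|]; [exact: tb|exact: (tb j I)].
Qed.

End borel_rV.

Section lebesgue_rV.
Context {R : realType}.
Local Open Scope ereal_scope.

Let cons_rV n (p : measurableTypeR R * 'rV[R]_n) : 'rV[R]_(1 + n) :=
  row_mx (p.1 : R)%:M p.2.
Let uncons_rV n (v : 'rV[R]_(1 + n)) : measurableTypeR R * 'rV[R]_n :=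
  (v ord0 (lshift n ord0), rsubmx v).

Let measurable_cons_rV n : measurable_fun setT (@cons_rV n).
Proof.
apply: measurable_fun_rV => j; rewrite /cons_rV.
case: (split_ordP j) => k ->.
- rewrite (_ : (fun _ => _) = fst); last first.
    by apply/funext => p; rewrite row_mxEl mxE [k]ord1.
  move=> mT A mA; exact: (@measurable_fst _ _ (measurableTypeR R) 'rV[R]_n mT A).
- rewrite (_ : (fun _ => _) = (fun v : 'rV_n => v ord0 k) \o snd); last first.
    by apply/funext => p; rewrite row_mxEr.
  exact: (measurableT_comp (measurable_coord k) measurable_snd).
Qed.

Let measurable_uncons_rV n : measurable_fun setT (@uncons_rV n).
Proof.
apply: measurable_fun_pair.
  by move=> mT A mA; exact: (@measurable_coord _ _ (lshift n ord0) mT A mA).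
apply: measurable_fun_rV => j.
rewrite (_ : (fun _ => _) = fun v : 'rV_(1 + n) => v ord0 (rshift 1 j)).
  exact: measurable_coord.
by apply/funext => v; rewrite mxE.
Qed.

Let cons_rVK n : cancel (@cons_rV n) (@uncons_rV n).
Proof.
by move=> [x v]; rewrite /uncons_rV row_mxKr /cons_rV row_mxEl mxE eqxx mulr1n.
Qed.

Section step.
Variables (n : nat) (m : {sigma_finite_measure set 'rV[R]_n -> \bar R}).

Definition lebesgue_rV_step : set 'rV[R]_n.+1 -> \bar R :=
  pushforward (@lebesgue_measure R \x m)
    (fun p => row_mx (p.1 : R)%:M p.2 : 'rV_n.+1).

Let measurable_step A : measurable A ->
  measurable ((fun p : measurableTypeR R * 'rV[R]_n =>
    row_mx (p.1 : R)%:M p.2 : 'rV_n.+1) @^-1` A).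
Proof. by move=> mA; rewrite -[X in measurable X]setTI; exact: measurable_cons_rV. Qed.

Let step0 : lebesgue_rV_step set0 = 0.
Proof. by rewrite /lebesgue_rV_step /pushforward preimage_set0 measure0. Qed.

Let step_ge0 A : 0 <= lebesgue_rV_step A.
Proof. exact: (measure_ge0 (@lebesgue_measure R \x m)). Qed.

Let step_sigma_additive : semi_sigma_additive lebesgue_rV_step.
Proof.
move=> F mF tF mUF; rewrite /lebesgue_rV_step /pushforward preimage_bigcup.
apply: measure_semi_sigma_additive.
- by move=> k; exact: measurable_step.
- apply/trivIsetP => /= i j _ _ ij; rewrite -preimage_setI.
  by move/trivIsetP : tF => /(_ _ _ _ _ ij) ->//; rewrite preimage_set0.
- by rewrite -preimage_bigcup; exact: measurable_step.
Qed.

HB.instance Definition _ := isMeasure.Build _ _ _ lebesgue_rV_step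
  step0 step_ge0 step_sigma_additive.

Let step_sigma_finite : sigma_finite setT lebesgue_rV_step.
Proof.
have /sigma_finiteP[F [UF ndF mF]] := sigma_finiteT (@lebesgue_measure R).
have /sigma_finiteP[G [UG ndG mG]] := sigma_finiteT m.
exists (fun k => @uncons_rV n @^-1` (F k `*` G k)).
  apply/seteqP; split=> // v _.
  have [k _ Fk] : (\bigcup_k F k) (uncons_rV v).1 by rewrite -UF.
  have [l _ Gl] : (\bigcup_k G k) (uncons_rV v).2 by rewrite -UG.
  exists (maxn k l) => //; split.
  - by apply: subsetPset Fk; exact/ndF/leq_maxl.
  - by apply: subsetPset Gl; exact/ndG/leq_maxr.
move=> k; have [mFk Fkoo] := mF k; have [mGk Gkoo] := mG k; split.
  rewrite -[X in measurable X]setTI; apply: measurable_uncons_rV => //.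
  exact: measurableX.
rewrite /lebesgue_rV_step /pushforward -comp_preimage.
rewrite (_ : _ \o _ = id); last by apply/funext => p; exact: (@cons_rVK n p).
by rewrite preimage_id product_measure1E// lte_mul_pinfty// ge0_fin_numE.
Qed.

HB.instance Definition _ := Measure_isSigmaFinite.Build _ _ _ lebesgue_rV_step
  step_sigma_finite.

End step.

(* The d-fold product of the one-dimensional Lebesgue measure, transported to
   row vectors one coordinate at a time. *)
Fixpoint lebesgue_rV (n : nat) : {sigma_finite_measure set 'rV[R]_n -> \bar R} :=
  match n with
  | 0 => @dirac _ 'rV[R]_0 0%R R
  | n'.+1 => lebesgue_rV_step (lebesgue_rV n')
  end.

Lemma lebesgue_rV_box n (a b : 'rV[R]_n) : (forall j, a ord0 j <= b ord0 j)%R ->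
  lebesgue_rV n [set v : 'rV[R]_n | forall j, v ord0 j \in `[a ord0 j, b ord0 j]] =
  (\prod_(j < n) (b ord0 j - a ord0 j))%:E.
Proof.
elim: n a b => [|n IH] a b ab.
  rewrite big_ord0 /= diracE mem_set// => j; by case: j.
rewrite /= /lebesgue_rV_step /pushforward.
rewrite (_ : _ @^-1` _ = `[a ord0 ord0, b ord0 ord0]%classic `*`
  [set v : 'rV_n | forall j, v ord0 j \in
    `[(\row_j a ord0 (lift ord0 j)) ord0 j,
     (\row_j b ord0 (lift ord0 j)) ord0 j]]); last first.
  have el (p : measurableTypeR R * 'rV[R]_n) :
      (row_mx (p.1 : R)%:M p.2 : 'rV_n.+1) ord0 ord0 = p.1.
    have -> : ord0 = lshift n (ord0 : 'I_1) by exact/val_inj.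
    by rewrite (@row_mxEl _ _ 1 n) mxE eqxx mulr1n.
  have er (p : measurableTypeR R * 'rV[R]_n) j :
      (row_mx (p.1 : R)%:M p.2 : 'rV_n.+1) ord0 (lift ord0 j) = p.2 ord0 j.
    have -> : lift ord0 j = rshift 1 j by exact/val_inj.
    by rewrite (@row_mxEr _ _ 1 n).
  apply/seteqP; split=> -[x v]/=.
    move=> h; split; first by have := h ord0; rewrite (el (x, v)).
    by move=> j; have := h (lift ord0 j); rewrite (er (x, v)) !mxE.
  move=> [h0 h] j; case: (unliftP ord0 j) => [k|] ->.
    by rewrite (er (x, v)); have := h k; rewrite !mxE.
  by rewrite (el (x, v)).
rewrite product_measure1E//.
  rewrite -[X in X * _]/(lebesgue_measure
    (`[a ord0 ord0, b ord0 ord0]%classic : set R)).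
  rewrite lebesgue_measure_itv/= lte_fin.
  set B := (X in lebesgue_rV n X).
  have -> : lebesgue_rV n B =
      (\prod_(j < n) (b ord0 (lift ord0 j) - a ord0 (lift ord0 j)))%:E.
    rewrite [LHS]IH => [|j]; last by rewrite !mxE.
    by congr _%:E; apply: eq_bigr => j _; rewrite !mxE.
  rewrite big_ord_recl.
  have := ab ord0; rewrite le_eqVlt => /predU1P[->|->].
    by rewrite ltxx mul0e subrr mul0r.
  by rewrite -EFinB -EFinM.
rewrite (_ : mkset _ = \bigcap_(j in [set: 'I_n])
  ((fun v : 'rV[R]_n => v ord0 j) @^-1` `[(\row_j a ord0 (lift ord0 j)) ord0 j,
     (\row_j b ord0 (lift ord0 j)) ord0 j]%classic)).
  apply: fin_bigcap_measurable => // j _; rewrite -[X in measurable X]setTI.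
  exact: measurable_coord.
by apply/seteqP; split=> v /= h j => [_|]; [exact: h|exact: (h j I)].
Qed.

End lebesgue_rV.

Record is_norm (R : realType) d (N : 'rV[R]_d -> R) : Prop := IsNorm {
  is_norm_triangle : forall x y, N (x + y) <= N x + N y ;
  is_norm_homogeneous : forall (a : R) x, N (a *: x) = `|a| * N x ;
  is_norm_definite : forall x, N x = 0 -> x = 0 }.

Definition norm_ball (R : realType) d (N : 'rV[R]_d -> R) (x : 'rV[R]_d) (r : R)
  : set 'rV[R]_d := [set y | N (x - y) <= r].

Definition unit_ball_volume (R : realType) d (N : 'rV[R]_d -> R) : R :=
  fine (lebesgue_rV d (norm_ball N 0 1)).

Definition Gamma {R : realType} (s : R) : R :=
  \int[lebesgue_measure]_(t in `]0, +oo[) (t `^ (s - 1) * expR (- t)).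

Section measures.
Context {R : realType} {d : nat}.
Implicit Types mu nu : {measure set 'rV[R]_d -> \bar R}.
Local Open Scope ereal_scope.

Definition measure_support (N : 'rV[R]_d -> R) mu : set 'rV[R]_d :=
  [set x | forall r : R, (0 < r)%R -> 0 < mu (norm_ball N x r)].

(* The first argument is only a set function so that one can write
   mu (. & U) without a proof that U is measurable. *)
Definition is_density (nu : set 'rV[R]_d -> \bar R) (p : 'rV[R]_d -> R) : Prop :=
  [/\ measurable_fun setT p, (forall x, 0 <= p x)%R &
      forall A, measurable A -> nu A = \int[lebesgue_rV d]_(x in A) (p x)%:E].

Definition couplings mu nu : set (probability ('rV[R]_d * 'rV[R]_d)%type R) :=
  [set g | (forall A, measurable A -> g (A `*` setT) = mu A) /\
           (forall A, measurable A -> g (setT `*` A) = nu A)].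

Definition wasserstein (N : 'rV[R]_d -> R) (q : R) mu nu : \bar R :=
  ereal_inf [set \int[g]_z (N (z.1 - z.2)%R `^ q)%:E | g in couplings mu nu]
    `^ q^-1.

End measures.

(* Samples are sequences indexed from 0, so that X_1, ..., X_n is
   (x i)_{i < n}. *)
Section empirical.
Context {R : realType} {d : nat} (N : 'rV[R]_d -> R).

Definition empirical (n : nat) (x : nat -> 'rV[R]_d) :
    {measure set 'rV[R]_d -> \bar R} :=
  mscale (n%:R^-1)%:nng (msum (fun i => \d_(x i)) n).

(* [find] on the increasing list 0, ..., m-1 returns the lowest minimizer. *)
Definition nn_index (m : nat) (y : nat -> 'rV[R]_d) (x : 'rV[R]_d) : nat :=
  find (fun j => [forall k : 'I_m, N (x - y j) <= N (x - y k)]) (iota 0 m).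

Definition nn_weight (n m : nat) (x y : nat -> 'rV[R]_d) (j : nat) :
    {nonneg R} :=
  (m%:R / n%:R * (\sum_(i < n) (j == nn_index m y (x i)))%N%:R)%:nng.

Definition nn_empirical (n m : nat) (x y : nat -> 'rV[R]_d) :
    {measure set 'rV[R]_d -> \bar R} :=
  mscale (m%:R^-1)%:nng
    (msum (fun j => mscale (nn_weight n m x y j) \d_(y j)) m).

End empirical.

Section samples.
Context {R : realType} d d' {T : measurableType d} {T' : measurableType d'}.
Variable P : probability T R.
Local Open Scope ereal_scope.

Definition mutually_independent (I : eqType) (X : I -> {RV P >-> T'}) : Prop :=
  forall (s : seq I) (A : I -> set T'), uniq s ->
    (forall i, i \in s -> measurable (A i)) ->
    P (\bigcap_(i in [set` s]) (X i @^-1` A i)) =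
    \prod_(i <- s) P (X i @^-1` A i).

Definition has_law (X : {RV P >-> T'}) (mu : probability T' R) : Prop :=
  forall A, measurable A -> distribution P X A = mu A.

(* All the variables X_0, X_1, ..., X'_0, X'_1, ... are pooled in one family:
   each sample is independent, and the two are independent of each other. *)
Definition two_iid_samples (muX muX' : probability T' R)
    (X X' : nat -> {RV P >-> T'}) : Prop :=
  [/\ forall i, has_law (X i) muX, forall j, has_law (X' j) muX' &
      mutually_independent
        (fun k : nat + nat => match k with inl i => X i | inr j => X' j end)].

End samples.

(* Main.v *)
From HB Require Import structures.
Require Import Defs.
From mathcomp Require Import all_boot all_order all_algebra.
From mathcomp Require Import all_classical all_reals all_analysis.
From mathcomp Require Import measurable_realfun ring lra.
Set Implicit Arguments.
Unset Strict Implicit.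
Unset Printing Implicit Defensive.
Import Order.TTheory GRing.Theory Num.Theory.
Import numFieldNormedType.Exports.
Local Open Scope classical_set_scope.
Local Open Scope ring_scope.

(** The cost of an optimal coupling of the two empirical measures is the mean
    over [i] of [min_j |X_i - X'_j|^q]: sending each [X_i] to its nearest
    neighbour is a coupling, and no coupling can do better. By the layer-cake
    formula and independence, [m^(q/d)] times the expectation of such a minimum
    is the integral over [x ~ mu_X] and [u > 0] of
    [(1 - mu_X'(B(x, r_m)))^m] with [r_m = u^(1/q) m^(-1/d)]. Since
    [m mu_X'(B(x, r_m))] tends to [p(x) v_d u^(d/q)], the integrand tends to
    [exp (- p(x) v_d u^(d/q))], whose integral in [u] is
    [Gamma (1 + q/d) / (p(x) v_d)^(q/d)].

    Dominated convergence applies on the product space. With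
    [A(x) = 2 |x| + constant], when [r_m <= A(x)] the ball contains the ball of
    radius [r_m r_kappa / A(x) <= r_kappa], so (b)(iii) gives the bound
    [exp (- c(x) u^(d/q))] with [c(x)] of order [p(x) / A(x)^d], and (c) makes
    it integrable. When [r_m > A(x)] the ball contains [B(0, r_m / 2)], and (a)
    gives a bound by a constant multiple of [1 / (1 + u^2)] for [m] large. *)

(** * Norms on row vectors *)

Section norm.
Context {R : realType} {d : nat} (N : 'rV[R]_d -> R).
Hypothesis N_norm : is_norm N.

Lemma is_norm0 : N 0 = 0.
Proof.
by have := is_norm_homogeneous N_norm 0 0; rewrite scaler0 normr0 mul0r.
Qed.

Lemma is_normN x : N (- x) = N x.
Proof.
by rewrite -scaleN1r (is_norm_homogeneous N_norm) normrN1 mul1r.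
Qed.

Lemma is_norm_ge0 x : 0 <= N x.
Proof.
have := is_norm_triangle N_norm x (- x).
by rewrite subrr is_norm0 is_normN -mulr2n pmulrn_lge0.
Qed.

Lemma is_norm_subC x y : N (x - y) = N (y - x).
Proof. by rewrite -is_normN opprB. Qed.

(** Expand [x] in the canonical basis. The summand 1 keeps the constant positive in dimension 0,
    where the sum is empty. *)
Lemma is_norm_le_mx_norm : exists2 C : R, 0 < C & forall x, N x <= C * `|x|.
Proof.
exists (1 + \sum_j N (delta_mx ord0 j)).
  by rewrite ltr_wpDr// sumr_ge0// => j _; exact: is_norm_ge0.
move=> x; apply: (@le_trans _ _ (\sum_j `|x| * N (delta_mx ord0 j))).
  rewrite [in leLHS](row_sum_delta x).
  elim/big_ind2 : _ => [|a b a' b' ab ab'|j _]; first by rewrite is_norm0.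
    by rewrite (le_trans (is_norm_triangle N_norm _ _))// lerD.
  rewrite (is_norm_homogeneous N_norm) ler_wpM2r ?is_norm_ge0//.
  by rewrite [leRHS]/Num.norm/= mx_normrE; exact: (le_bigmax _ _ (ord0, j)).
by rewrite -mulr_sumr [leRHS]mulrC mulrDr mulr1 lerDr.
Qed.

Lemma is_norm_lipschitz x y : `|N x - N y| <= N (x - y).
Proof.
rewrite ler_norml; apply/andP; split.
  rewrite lerNl opprB lerBlDr is_norm_subC.
  by rewrite (le_trans _ (is_norm_triangle N_norm _ _))// subrK.
by rewrite lerBlDr (le_trans _ (is_norm_triangle N_norm _ _))// subrK.
Qed.

Lemma is_norm_continuous : continuous N.
Proof.
have [C C0 NC] := is_norm_le_mx_norm.
move=> x; apply/(@cvgrPdist_le _ _ _ _ (nbhs_filter x)) => e e0.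
apply/nbhs_ballP; exists (e / C); first exact: divr_gt0.
move=> y; rewrite mx_norm_ball /ball_/= => /ltW.
rewrite ler_pdivlMr// mulrC => Cxy.
by rewrite (le_trans (is_norm_lipschitz _ _))// (le_trans (NC _)).
Qed.

(** Compactness of the sup-norm unit sphere: [N] attains a minimum there, definiteness makes it
    positive, and homogeneity extends the bound to all vectors. *)
Lemma is_norm_ge_mx_norm : exists2 c : R, 0 < c & forall x, c * `|x| <= N x.
Proof.
pose S := [set x : 'rV[R]_d | `|x| = 1].
(* If the sphere is empty, every vector is zero, since a nonzero one could be normalized; any
   constant then works. *)
have [[x0 Sx0]|S0] := pselect (S !=set0); last first.
  exists 1 => // x; rewrite mul1r.
  have [->|x0] := eqVneq x 0; first by rewrite normr0 is_norm_ge0.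
  exfalso; apply: S0; exists (`|x|^-1 *: x).
  by rewrite /S/= normrZ normfV normr_id mulVf// normr_eq0.
have cS : compact S.
  apply: bounded_closed_compact.
    by exists 1; split => // y y1 x; rewrite /S/= => ->; exact: ltW.
  have -> : S = (fun x : 'rV[R]_d => `|x|) @^-1` [set 1] by [].
  apply: closed_comp; last exact: closed_eq.
  by move=> x _; exact: norm_continuous.
have [||c /[!inE] Sc cmin] := EVT_min_rV (f := N) _ cS.
- by exists x0.
- by apply: continuous_subspaceT; exact: is_norm_continuous.
have Nc0 : 0 < N c.
  rewrite lt_neqAle is_norm_ge0 andbT eq_sym; apply/eqP.
  move=> /(is_norm_definite N_norm) c0.
  by move: Sc; rewrite /S/= c0 normr0 => /eqP; rewrite eq_sym oner_eq0.
exists (N c) => // x.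
have [->|x_neq0] := eqVneq x 0; first by rewrite normr0 mulr0 is_norm_ge0.
have xgt0 : 0 < `|x| by rewrite normr_gt0.
have := cmin (`|x|^-1 *: x); rewrite inE /S/= normrZ normfV normr_id.
rewrite mulVf ?gt_eqF// => /(_ erefl).
by rewrite (is_norm_homogeneous N_norm) normfV normr_id ler_pdivlMl// mulrC.
Qed.

Lemma measurable_is_norm : measurable_fun setT N.
Proof. apply: continuous_measurable_rV; exact: is_norm_continuous. Qed.

End norm.

Section measurable_norm.
Context {R : realType} {d : nat} (N : 'rV[R]_d -> R).
Hypothesis N_norm : is_norm N.
Context d1 {T : measurableType d1}.

Lemma measurable_fun_rVB (f g : T -> 'rV[R]_d) : measurable_fun setT f ->
  measurable_fun setT g -> measurable_fun setT (fun t => f t - g t).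
Proof.
move=> mf mg; apply: measurable_fun_rV => j.
under eq_fun do rewrite !mxE.
apply: measurable_funB; exact: (measurableT_comp (measurable_coord j)).
Qed.

Lemma measurable_norm_sub (f g : T -> 'rV[R]_d) : measurable_fun setT f ->
  measurable_fun setT g -> measurable_fun setT (fun t => N (f t - g t)).
Proof.
move=> mf mg; apply: (measurableT_comp (measurable_is_norm N_norm)).
exact: measurable_fun_rVB.
Qed.

End measurable_norm.

Lemma measurable_norm_ball (R : realType) d (N : 'rV[R]_d -> R) x r :
  is_norm N -> measurable (norm_ball N x r).
Proof.
move=> N_norm.
have -> : norm_ball N x r = setT `&` (fun y => N (x - y)) @^-1` `]-oo, r].
  by rewrite setTI; apply/seteqP; split => y /=; rewrite in_itv.
exact: (measurable_norm_sub N_norm).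
Qed.

(** * Optimal transport cost between the empirical measures *)

Section bigmin.
Context {R : realType}.

Lemma measurable_fun_bigmin d (T : measurableType d) (I : Type) (s : seq I)
    (f0 : T -> R) (f : I -> T -> R) : measurable_fun setT f0 ->
    (forall i, measurable_fun setT (f i)) ->
  measurable_fun setT (fun t => \big[Num.min/f0 t]_(i <- s) f i t).
Proof.
move=> mf0 mf; elim: s => [|i s IH].
  by under eq_fun do rewrite big_nil.
by under eq_fun do rewrite big_cons; exact: measurable_minr.
Qed.

End bigmin.

Section nearest_neighbour.
Context {R : realType} {d : nat} (N : 'rV[R]_d -> R).

(** Starting the minimum from the distance to [y 0] avoids an infinite neutral element; for [m > 0]
    this distance is already among the terms. *)
Definition nn_dist m (y : nat -> 'rV[R]_d) x :=
  \big[Num.min/N (x - y 0%N)]_(j < m) N (x - y j).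

Lemma nn_dist_gt m y x r : (0 < m)%N ->
  (r < nn_dist m y x) <-> (forall j, (j < m)%N -> r < N (x - y j)).
Proof.
move=> m0; split.
  by move=> /bigmin_gtP[_ h] j jm; exact: (h (Ordinal jm)).
by move=> h; apply/bigmin_gtP; split=> [|j _]; [exact: h|exact: h].
Qed.

Lemma nn_dist_le m y x j : (j < m)%N -> nn_dist m y x <= N (x - y j).
Proof. by move=> jm; exact: (bigmin_le _ (Ordinal jm)). Qed.

Lemma nn_indexP m y x : (0 < m)%N ->
  (nn_index N m y x < m)%N /\ N (x - y (nn_index N m y x)) = nn_dist m y x.
Proof.
move=> m0; rewrite /nn_index; set a := (X in find X _).
have ha : has a (iota 0 m).
  have [/= i _ imin] := @arg_minP _ R 'I_m (Ordinal m0) xpredT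
    (fun k => N (x - y k)) isT.
  apply/hasP; exists (val i); first by rewrite mem_iota/= add0n.
  by apply/forallP => k; exact: imin.
have fm : (find a (iota 0 m) < m)%N by rewrite -[ltnRHS](size_iota 0) -has_find.
split => //; apply/eqP; rewrite eq_le nn_dist_le// andbT.
have := nth_find 0%N ha; rewrite nth_iota// add0n => /forallP amin.
by apply/bigmin_geP; split=> [|j _]; [exact: (amin (Ordinal m0))|exact: amin].
Qed.

Hypothesis N_norm : is_norm N.

Lemma nn_dist_ge0 m y x : 0 <= nn_dist m y x.
Proof. by apply/bigmin_geP; split=> [|j _]; exact: is_norm_ge0. Qed.

Lemma measurable_nn_dist d' (T : measurableType d') m
    (y : nat -> T -> 'rV[R]_d) (x : T -> 'rV[R]_d) : (0 < m)%N ->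
  (forall j, (j < m)%N -> measurable_fun setT (y j)) -> measurable_fun setT x ->
  measurable_fun setT (fun t => nn_dist m (y^~ t) (x t)).
Proof.
move=> m0 my mx; apply: measurable_fun_bigmin => [|j];
  by apply: (measurable_norm_sub N_norm) => //; exact: my.
Qed.

End nearest_neighbour.

Section average.
Context {R : realType} d (T : measurableType d).

(** The construction of [empirical] over any measurable type, so that it also applies to pairs of
    points when building a coupling. *)
Definition average n (z : nat -> T) : {measure set T -> \bar R} :=
  mscale (n%:R^-1)%:nng (msum (fun i => \d_(z i)) n).

Local Open Scope ereal_scope.

Lemma averageE n (z : nat -> T) A :
  average n z A = (n%:R^-1)%R%:E * \sum_(i < n) \d_(z i) A.
Proof. by []. Qed.

Lemma integral_average n (z : nat -> T) (f : T -> \bar R) :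
    measurable_fun setT f -> (forall t, 0 <= f t) ->
  \int[average n z]_t f t =
  (n%:R^-1)%R%:E * \sum_(i < n) f (z i).
Proof.
move=> mf f0; rewrite ge0_integral_mscale//= ge0_integral_measure_sum//.
congr (_ * _); apply: eq_bigr => i _.
by rewrite integral_dirac// diracT mul1e.
Qed.

(** Elements of [couplings] are bundled probabilities, so the average has to be packaged as one. Its
    mass is 1, so [mnormalize] leaves it unchanged; the Dirac mass is only the fallback for a mass
    of 0 or infinity. *)
Lemma exists_average_probability n (z : nat -> T) : (0 < n)%N ->
  exists g : probability T R, forall A,
    g A = average n z A.
Proof.
move=> n0; pose mu := average n z.
have mu1 : mu setT = 1.
  rewrite /mu averageE (eq_bigr (fun=> 1)) => [|i _]; last exact: diracT.
  by rewrite sumEFin -EFinM sumr_const card_ord mulVf// pnatr_eq0 -lt0n.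
exists (mnormalize mu \d_(z 0%N)) => A.
by rewrite /= /mnormalize mu1/= onee_eq0/= invr1 mule1.
Qed.

End average.

Section wasserstein_nn.
Context {R : realType} {d : nat} (N : 'rV[R]_d -> R).
Hypothesis N_norm : is_norm N.
Variables (n m : nat) (x y : nat -> 'rV[R]_d).
Hypotheses (n0 : (0 < n)%N) (m0 : (0 < m)%N).
Local Open Scope ereal_scope.

Local Notation J := (nn_index N m y).

Lemma nn_empiricalE A : nn_empirical N n m x y A =
  (n%:R^-1)%R%:E * \sum_(i < n) \d_(y (J (x i))) A.
Proof.
rewrite /nn_empirical/= /mscale/= /msum/=.
under eq_bigr do rewrite /mscale/= diracE -EFinM.
rewrite sumEFin -EFinM.
under [in RHS]eq_bigr do rewrite diracE.
rewrite sumEFin -EFinM; congr _%:E.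
under eq_bigr do rewrite natr_sum mulr_sumr mulr_suml.
(* After exchanging the sums, exactly one [j] contributes for each [i], and the factors [m]
   cancel. *)
rewrite exchange_big/= !mulr_sumr; apply: eq_bigr => i _.
have [Jm _] := nn_indexP N y (x i) m0.
rewrite (bigD1 (Ordinal Jm))//= eqxx mulr1 big1 ?addr0 => [|j].
  by rewrite !mulrA mulVf ?mul1r ?pnatr_eq0 -?lt0n.
by rewrite -val_eqE/= => /negbTE ->; rewrite mulr0 mul0r.
Qed.

Lemma wasserstein_nn (q : R) : (1 <= q)%R ->
  wasserstein N q (empirical n x) (nn_empirical N n m x y) `^ q =
  ((n%:R^-1)%R%:E * \sum_(i < n) (nn_dist N m y (x i) `^ q)%:E).
Proof.
move=> q1; have q_neq0 : q != 0%R by rewrite gt_eqF// (lt_le_trans ltr01).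
rewrite /wasserstein -poweRrM mulVf// poweRe1; last first.
  by apply/ereal_infP => _ [g _ <-]; apply: integral_ge0 => z _;
    rewrite lee_fin powR_ge0.
have mc : measurable_fun setT
  (fun z : 'rV[R]_d * 'rV[R]_d => (N (z.1 - z.2) `^ q)%:E).
  apply/measurable_EFinP; apply: (measurableT_comp (measurable_powR q)).
  exact: (measurable_norm_sub N_norm).
have mh : measurable_fun setT (fun z => (nn_dist N m y z `^ q)%:E).
  apply/measurable_EFinP; apply: (measurableT_comp (measurable_powR q)).
  exact: (@measurable_nn_dist _ _ _ N_norm _ _ m (fun j => cst (y j)) id).
apply/eqP; rewrite eq_le; apply/andP; split.
  (* Upper bound: the coupling that gives mass [1/n] to each pair of [x i] and its nearest
     neighbour. *)
  have [g gE] := @exists_average_probability R _ _ n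
    (fun i => (x i, y (J (x i)))) n0.
  apply: ereal_inf_lbound; exists g.
    split=> A mA; rewrite gE averageE; last rewrite nn_empiricalE.
      rewrite /empirical averageE; congr (_ * _); apply: eq_bigr => i _.
      rewrite !diracE; congr (_%:R)%:E; congr nat_of_bool.
      by apply/idP/idP; rewrite !inE => // -[].
    congr (_ * _); apply: eq_bigr => i _.
    rewrite !diracE; congr (_%:R)%:E; congr nat_of_bool.
    by apply/idP/idP; rewrite !inE => // -[].
  rewrite (eq_measure_integral (average n (fun i => (x i, y (J (x i))))));
    last first.
    by move=> A mA _; exact: gE.
  rewrite integral_average//; last by move=> z; rewrite lee_fin powR_ge0.
  congr (_ * _); apply: eq_bigr => i _ /=.
  by have [_ ->] := nn_indexP N y (x i) m0.
apply/ereal_infP => _ [g [g1 g2] <-].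
(* Lower bound: the claimed cost depends only on the first marginal, so it can be written as an
   integral against any coupling [g]. *)
have -> : (n%:R^-1)%R%:E * \sum_(i < n) (nn_dist N m y (x i) `^ q)%:E =
    \int[g]_z (nn_dist N m y z.1 `^ q)%:E.
  rewrite -(@integral_average R _ _ n x (fun z => (nn_dist N m y z `^ q)%:E))//;
    last first.
    by move=> z; rewrite lee_fin powR_ge0.
  rewrite (eq_measure_integral (pushforward g fst)); last first.
    move=> A mA _; rewrite -[LHS]/(empirical n x A) -g1//; congr (g _).
    by apply/seteqP; split=> z //= [].
  rewrite ge0_integral_pushforward// => z _.
  by rewrite lee_fin powR_ge0.
(* A coupling is concentrated on pairs whose second point lies in [Y], so
   its integrand dominates the minimal distance to the [y j]. *)
pose Y := [set y (J (x i)) | i in `I_n].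
have mY : measurable Y.
  (* [Y] is a finite union of singletons, and these are measurable as balls of radius 0. *)
  rewrite (_ : Y = \bigcup_(i < n) norm_ball N (y (J (x i))) 0).
    by apply: bigcup_measurable => i _; exact: measurable_norm_ball.
  apply/seteqP; split=> z /=.
    by move=> [i /= ilt <-]; exists i => //=;
      rewrite /norm_ball/= subrr is_norm0.
  move=> [i ilt]; rewrite /norm_ball/= => zle; exists i => //.
  apply/eqP; rewrite -subr_eq0; apply/eqP/(is_norm_definite N_norm).
  by apply/eqP; rewrite eq_le zle is_norm_ge0.
apply: ae_ge0_le_integral => //.
- by move=> z _; rewrite lee_fin powR_ge0.
- exact: (measurableT_comp mh measurable_fst).
- by move=> z _; rewrite lee_fin powR_ge0.
- exists (setT `*` ~` Y); split.
  + by apply: measurableX => //; exact: measurableC.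
  + transitivity (nn_empirical N n m x y (~` Y)).
      by rewrite -g2//; exact: measurableC.
    rewrite nn_empiricalE big1 ?mule0// => i _.
    by rewrite diracE memNset// => -[]; exists (val i) => //=.
  + move=> z /= h; split => // -[i /= ilt yE]; apply: h => _.
    rewrite lee_fin ge0_ler_powR ?nnegrE ?nn_dist_ge0 ?is_norm_ge0//.
    - by rewrite (le_trans ler01).
    - rewrite -yE; apply: nn_dist_le.
      by have [] := nn_indexP N y (x i) m0.
Qed.

End wasserstein_nn.

(** * Law of the nearest-neighbour distance *)

Section independence.
Context {R : realType} {d d1 d2 : measure_display} {T : measurableType d}
  (P : probability T R).
Context {T1 : measurableType d1} {T2 : measurableType d2}.
Local Open Scope ereal_scope.

(** Independence says that the law of the pair agrees with the product of the laws on rectangles,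
    hence everywhere; the right-hand side is that product measure computed by sections. *)
Lemma independent_joint_law (U : {RV P >-> T1}) (V : {RV P >-> T2}) :
    (forall A B, measurable A -> measurable B ->
       P (U @^-1` A `&` V @^-1` B) = P (U @^-1` A) * P (V @^-1` B)) ->
  forall E : set (T1 * T2), measurable E ->
    P [set w | E (U w, V w)] =
    \int[distribution P U]_x P (V @^-1` (xsection E x)).
Proof.
move=> UV E mE.
have mUV : measurable_fun setT (fun w => (U w, V w)).
  by apply: measurable_fun_pair.
pose W : {RV P >-> (T1 * T2)%type} :=
  HB.pack (fun w => (U w, V w)) (isMeasurableFun.Build _ _ _ _ _ mUV).
transitivity ((distribution P U \x distribution P V) E) => //.
rewrite (@product_measure_unique _ _ T1 T2 R (distribution P U)
  (distribution P V) (distribution P W) _ E mE)//.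
Qed.

End independence.

Section samples.
Context {R : realType} {d : measure_display} {T : measurableType d}
  (P : probability T R).
Context {d' : measure_display} {T' : measurableType d'}
  (muX muX' : probability T' R).
Variables (X X' : nat -> {RV P >-> T'}).
Hypothesis XX' : two_iid_samples muX muX' X X'.
Variable m : nat.
Local Open Scope ereal_scope.

Lemma sample_law (A : nat -> set T') : (forall j, measurable (A j)) ->
  P (\bigcap_(j < m) X' j @^-1` A j) = \prod_(j < m) muX' (A j).
Proof.
move=> mA; have [_ lX' ind] := XX'.
have := ind [seq inr j | j <- iota 0 m]
  (fun k => match k with inl _ => setT | inr j => A j end).
rewrite map_inj_uniq ?iota_uniq => [|? ? []//] /(_ isT) /(_ _)/wrap[].
  by move=> [i|j] _.
rewrite big_map -[X in iota 0 X](subn0 m) big_mkord.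
rewrite (eq_bigr (fun j : 'I_m => muX' (A j))) => [<-|j _]; last exact: lX'.
congr (P _); apply/seteqP; split=> w /= h.
  move=> k /mapP[j]; rewrite mem_iota/= add0n subn0 => jm ->.
  exact: h.
by move=> j jm; apply: (h (inr j)); apply/mapP; exists j;
  rewrite // mem_iota/= add0n ?subn0.
Qed.

Lemma samples_law i (B : set T') (A : nat -> set T') : measurable B ->
  (forall j, measurable (A j)) ->
  P (X i @^-1` B `&` \bigcap_(j < m) X' j @^-1` A j) =
  P (X i @^-1` B) * P (\bigcap_(j < m) X' j @^-1` A j).
Proof.
move=> mB mA; rewrite sample_law//; have [_ lX' ind] := XX'.
have := ind (inl i :: [seq inr j | j <- iota 0 m])
  (fun k => match k with inl _ => B | inr j => A j end).
rewrite /= map_inj_uniq ?iota_uniq => [|? ? []//].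
have -> : inl i \notin [seq inr j | j <- iota 0 m] by apply/mapP => -[].
move=> /(_ isT) /(_ _)/wrap[].
  by move=> [?|?] _.
rewrite big_cons big_map -[X in iota 0 X](subn0 m) big_mkord.
rewrite (eq_bigr (fun j : 'I_m => muX' (A j))) => [<-|j _]; last exact: lX'.
congr (P _); apply/seteqP; split=> w /=.
  move=> [h0 h] k /=; rewrite inE => /predU1P[->//|/mapP[j]].
  rewrite mem_iota/= add0n subn0 => jm ->; exact: h.
move=> h; split; first by apply: (h (inl i)); rewrite /= mem_head.
move=> j jm; apply: (h (inr j)); rewrite /= inE; apply/orP; right.
by apply/mapP; exists j; rewrite // mem_iota/= add0n ?subn0.
Qed.

Let cylinder : set (set T) := [set C | exists2 A : nat -> set T',
  (forall j, measurable (A j)) & C = \bigcap_(j < m) X' j @^-1` A j].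

Let measurable_cylinder : cylinder `<=` measurable.
Proof.
move=> _ [A mA ->]; apply: bigcap_measurableType => j _.
by rewrite -[X in measurable X]setTI; exact: measurable_funP.
Qed.

Let setI_cylinder : setI_closed cylinder.
Proof.
move=> _ _ [A mA ->] [B mB ->]; exists (fun j => A j `&` B j).
  by move=> j; exact: measurableI.
by rewrite -bigcapI.
Qed.

Let cylinderT : cylinder setT.
Proof.
exists (fun=> setT) => //.
by apply/seteqP; split => // w _ j _.
Qed.

(* Only the first [m] variables of the second sample matter: the sample point
   itself, seen through the sigma-algebra they generate, plays the role of the
   vector [(X'_0, ..., X'_(m-1))]. *)
Let Tcyl := g_sigma_algebraType cylinder.

(** As functions of [C], both sides are finite measures that agree on the cylinders, a class stable
    under intersection, hence on the sigma-algebra it generates. *)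
Let samples_independent i (B : set T') (C : set T) : measurable B ->
  <<s cylinder >> C -> P (X i @^-1` B `&` C) = P (X i @^-1` B) * P C.
Proof.
move=> mB sC.
have mXB : measurable (X i @^-1` B).
  by rewrite -[X in measurable X]setTI; exact: measurable_funP.
pose c : {nonneg R} := NngNum (fine_ge0 (measure_ge0 P (X i @^-1` B))).
have := @g_sigma_algebra_measure_unique _ R T cylinder measurable_cylinder
  (fun=> setT) (fun=> cylinderT) _ (mrestr P mXB) (mscale c P) setI_cylinder _ _
    C sC.
rewrite /mrestr/= setIC /mscale/= fineK ?fin_num_measure//; apply.
- by rewrite bigcup_const//; exists 0%N.
- move=> _ [A mA ->].
  by rewrite /mrestr setIC samples_law.
- by move=> _; rewrite /mrestr setTI ltey_eq fin_num_measure.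
Qed.

Lemma samples_joint_law i (E : set (T' * Tcyl)) : measurable E ->
  P [set w | E (X i w, w)] = \int[muX]_x P [set w | E (x, w)].
Proof.
move=> mE; have [lX _ _] := XX'.
(* The identity, read into the coarser sigma-algebra, is the random variable to be declared
   independent of [X i]. *)
have mid : measurable_fun setT (id : T -> Tcyl).
  move=> _ A mA; rewrite setTI.
  apply: (smallest_sub _ measurable_cylinder mA).
  exact: sigma_algebra_measurable.
pose V : {RV P >-> Tcyl} :=
  HB.pack (id : T -> Tcyl) (isMeasurableFun.Build _ _ _ _ _ mid).
have -> : P [set w | E (X i w, w)] = P [set w | E (X i w, V w)] by [].
rewrite independent_joint_law//; last first.
  move=> A B mA mB; exact: samples_independent.
rewrite (eq_measure_integral muX); last by move=> A mA _; exact: lX.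
by apply: eq_integral => x _; congr (P _); apply/seteqP; split=> w /=;
  rewrite /xsection/= inE.
Qed.

Lemma measurable_sample_cyl j : (j < m)%N ->
  measurable_fun setT (X' j : Tcyl -> T').
Proof.
move=> jm _ A mA; rewrite setTI; apply: sub_sigma_algebra.
exists (fun k => if k == j then A else setT); first by move=> k; case: ifP.
apply/seteqP; split=> w /=; last by move=> /(_ _ jm); rewrite eqxx.
by move=> Aw k km; have [->|] := eqVneq k j.
Qed.

End samples.

Section nn_dist_law.
Context {R : realType} {d : nat} (N : 'rV[R]_d -> R).
Hypothesis N_norm : is_norm N.
Context {disp : measure_display} {T : measurableType disp}.
Variables (P : probability T R) (muX muX' : probability 'rV[R]_d R).
Variables (X X' : nat -> {RV P >-> 'rV[R]_d}).
Hypothesis XX' : two_iid_samples muX muX' X X'.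

Definition tail_ball x r : R := fine (muX' (~` norm_ball N x r)).

Lemma tail_ballE x r : (tail_ball x r)%:E = muX' (~` norm_ball N x r).
Proof.
rewrite fineK// fin_num_measure//.
by apply: measurableC; exact: measurable_norm_ball.
Qed.

(** The minimum exceeds [r] exactly when all [m] independent points miss the ball. *)
Lemma nn_dist_tail m x r : (0 < m)%N ->
  P [set w | r < nn_dist N m (X' ^~ w) x] = (tail_ball x r ^+ m)%:E.
Proof.
move=> m0.
have mB : measurable (~` norm_ball N x r).
  by apply: measurableC; exact: measurable_norm_ball.
transitivity (P (\bigcap_(j < m) X' j @^-1` (~` norm_ball N x r))).
  congr (P _); apply/seteqP; split=> w /=.
    by move=> /(nn_dist_gt _ _ _ _ m0) h j /h;
      rewrite /norm_ball/= real_ltNge ?num_real// => /negP.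
  move=> h; apply/(nn_dist_gt _ _ _ _ m0) => j /h.
  by rewrite /norm_ball/= real_ltNge ?num_real// => /negP.
rewrite (sample_law XX' _ (fun=> mB)) -tail_ballE.
by rewrite prodEFin prodr_const card_ord.
Qed.

(** Conditioning on [X i] reduces to a deterministic centre. The event has to be measurable for the
    sigma-algebra of the first [m] points alone, hence the type [Tc]. *)
Lemma nn_dist_law i m r : (0 < m)%N ->
  P [set w | r < nn_dist N m (X' ^~ w) (X i w)] =
  (\int[muX]_x (tail_ball x r ^+ m)%:E)%E.
Proof.
move=> m0.
pose Tc := g_sigma_algebraType [set C : set T | exists2 A : nat -> set 'rV[R]_d,
  (forall j, measurable (A j)) & C = \bigcap_(j < m) X' j @^-1` A j].
pose E := [set z : 'rV[R]_d * Tc | r < nn_dist N m (X' ^~ z.2) z.1].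
have mE : measurable E.
  have -> : E = setT `&` (fun z : 'rV[R]_d * Tc => nn_dist N m (X' ^~ z.2) z.1)
    @^-1` `]r, +oo[.
    by rewrite setTI; apply/seteqP; split => z /=; rewrite in_itv/= andbT.
  have mf : measurable_fun setT
    (fun z : 'rV[R]_d * Tc => nn_dist N m (X' ^~ z.2) z.1).
    have mX j : (j < m)%N -> measurable_fun setT
      (fun z : 'rV[R]_d * Tc => X' j z.2).
      move=> jm.
      exact: (@measurableT_comp _ _ _ _ _ _ (X' j : Tc -> 'rV[R]_d) _ snd
        (measurable_sample_cyl jm) (@measurable_snd _ _ _ _)).
    exact: (@measurable_nn_dist _ _ _ N_norm _ _ m _ fst m0 mX
      (@measurable_fst _ _ _ _)).
  exact: mf.
rewrite (samples_joint_law XX' i mE).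
by apply: eq_integral => x _; rewrite -nn_dist_tail.
Qed.

End nn_dist_law.

(** * Lebesgue measure of balls *)

(* The measure instance on [pushforward] needs the measurability of [f], which
   unification cannot supply. *)
Definition image_measure {d d' : measure_display} {T1 : measurableType d}
    {T2 : measurableType d'} {R : realType} (m : {measure set T1 -> \bar R})
    (f : T1 -> T2) (mf : measurable_fun setT f) :
    {measure set T2 -> \bar R} :=
  ltac:(refine (pushforward m f); exact mf).

Section lebesgue_affine.
Context {R : realType}.
Local Notation GR := (measurableTypeR R).

Lemma measurable_affine (c r : R) :
  measurable_fun setT ((fun t => c + r * t) : GR -> GR).
Proof. by apply: measurable_funD => //; exact: measurable_funM. Qed.

(** Both sides are measures in [A], so comparing them on half-open intervals is enough. *)
Lemma lebesgue_measure_affine (c r : R) (A : set GR) : 0 < r -> measurable A ->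
  (lebesgue_measure A = r%:E * lebesgue_measure
    ((fun t : GR => c + r * t)%R @^-1` A))%E.
Proof.
move=> r0 mA.
have mf := measurable_affine c r.
pose mu : {measure set GR -> \bar R} :=
  mscale (NngNum (ltW r0)) (image_measure (@lebesgue_measure R) mf).
suff ocE X : ocitv X -> lebesgue_measure X = mu X.
  exact: (lebesgue_measure_unique ocE mA).
move=> [[a b] _ <-].
rewrite /mu/= /mscale /image_measure/= /pushforward.
have -> : (fun t : GR => c + r * t) @^-1` `]a, b] =
  `](a - c) / r, (b - c) / r]%classic.
  apply/seteqP; split => t /=; rewrite !in_itv/= ltr_pdivrMr// ler_pdivlMr//;
    by rewrite ltrBlDl lerBrDl mulrC.
rewrite !lebesgue_measure_itv/= !lte_fin ltr_pM2r ?invr_gt0// ltrD2r.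
case: ifPn => _; last by rewrite mule0.
rewrite -!EFinB -EFinM; congr _%:E.
by rewrite -mulrBl mulrCA divff ?gt_eqF// mulr1; ring.
Qed.

Lemma measurable_affine_rV n (c : 'rV[R]_n) (r : R) :
  measurable_fun setT (fun v : 'rV[R]_n => c + r *: v).
Proof.
apply: measurable_fun_rV => j; under eq_fun do rewrite !mxE.
apply: measurable_funD => //; apply: measurable_funM => //.
exact: measurable_coord.
Qed.

Lemma measurable_row_cons n : measurable_fun setT
  (fun p : GR * 'rV[R]_n => row_mx (p.1 : R)%:M p.2 : 'rV[R]_n.+1).
Proof.
apply: (@measurable_fun_rV R _ _ (1 + n)) => j.
case: (split_ordP j) => k ->.
  rewrite (_ : (fun _ => _) = fst) => [mT A mA|].
    exact: (@measurable_fst _ _ GR 'rV[R]_n mT A).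
  by apply/funext => p; rewrite row_mxEl mxE [k]ord1.
under eq_fun do rewrite row_mxEr.
exact: (measurableT_comp (measurable_coord k) measurable_snd).
Qed.

(** Induction on the dimension: the rescaled image of the product measure under the map acting on
    each factor has the right value on rectangles, so it is the product measure. *)
Lemma lebesgue_rV_affine n (c : 'rV[R]_n) (r : R) (A : set 'rV[R]_n) : 0 < r ->
  measurable A ->
  (lebesgue_rV n A = (r ^+ n)%:E * lebesgue_rV n
    ((fun v : 'rV[R]_n => c + r *: v)%R @^-1` A))%E.
Proof.
move=> r0; elim: n => [|n IH] in c A *.
  move=> mA; rewrite expr0 mul1e; congr (lebesgue_rV 0 _).
  by apply/seteqP; split=> v /=; rewrite (thinmx0 v) (thinmx0 (c + _)).
move=> mA.
pose c0 : R := c ord0 ord0.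
pose c1 : 'rV[R]_n := \row_j c ord0 (lift ord0 j).
pose phi (z : GR * 'rV[R]_n) : GR * 'rV[R]_n := (c0 + r * z.1, c1 + r *: z.2).
have mphi : measurable_fun setT phi.
  apply: measurable_fun_pair.
    exact: (measurableT_comp (measurable_affine c0 r) measurable_fst).
  exact: (measurableT_comp (measurable_affine_rV c1 r) measurable_snd).
pose rn : {nonneg R} := NngNum (exprn_ge0 n.+1 (ltW r0)).
pose mu := mscale rn (image_measure (@lebesgue_measure R \x lebesgue_rV n)%E
  mphi).
pose cons (p : GR * 'rV[R]_n) := row_mx (p.1 : R)%:M p.2 : 'rV[R]_n.+1.
have mcons : measurable (cons @^-1` A).
  by rewrite -[X in measurable X]setTI; exact: measurable_row_cons.
transitivity (mu (cons @^-1` A)).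
  apply: (product_measure_unique _ mcons) => B C mB mC.
  rewrite /mu/= /mscale /image_measure/= /pushforward.
  rewrite (_ : phi @^-1` _ = ((fun t => c0 + r * t) @^-1` B) `*`
    ((fun v => c1 + r *: v) @^-1` C)); last first.
    by apply/seteqP; split.
  rewrite product_measure1E; last 2 first.
  - by rewrite -[X in measurable X]setTI; exact: measurable_affine.
  - by rewrite -[X in measurable X]setTI; exact: measurable_affine_rV.
  by rewrite (lebesgue_measure_affine c0 r0 mB) (IH c1 C mC) exprS EFinM
    muleACA.
rewrite /mu/= /mscale /image_measure/= /lebesgue_rV_step /pushforward;
  congr (_ * _)%E.
congr ((_ \x _)%E _).
(* It remains that [cons] intertwines [phi] with the affine map in dimension [n.+1]. *)
rewrite -comp_preimage -[RHS]comp_preimage; congr (_ @^-1` A).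
apply/funext => -[t v]; apply/rowP => j /=.
rewrite /cons /phi/= [RHS]mxE [X in _ = _ + X]mxE.
case: (split_ordP (j : 'I_(1 + n))) => k ->.
  rewrite !(@row_mxEl _ _ 1 n) !mxE [k]ord1 eqxx !mulr1n.
  by rewrite /c0; congr (c _ _ + _); exact/val_inj.
rewrite !(@row_mxEr _ _ 1 n) !mxE.
by congr (c _ _ + _); exact/val_inj.
Qed.

End lebesgue_affine.

Section ball_volume.
Context {R : realType} {d : nat} (N : 'rV[R]_d -> R).
Hypothesis N_norm : is_norm N.

Lemma mx_norm_coord_le (v : 'rV[R]_d) (a : R) : 0 <= a ->
  (`|v| <= a) <-> (forall j, v ord0 j \in `[- a, a]).
Proof.
move=> a0; rewrite [`|v|]/Num.norm/= mx_normrE; split.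
  move=> /bigmax_leP[_ va] j; rewrite in_itv/= -ler_norml.
  exact: (va (ord0, j)).
move=> va; apply/bigmax_leP; split=> // -[i j] _ /=.
by rewrite [i]ord1 ler_norml; have := va j; rewrite in_itv.
Qed.

Lemma measurable_mx_ball (a : R) : measurable [set v : 'rV[R]_d | `|v| <= a].
Proof.
have -> : [set v : 'rV[R]_d | `|v| <= a] = setT `&` (fun v : 'rV[R]_d => `|v|)
  @^-1` `]-oo, a].
  by rewrite setTI; apply/seteqP; split => y /=; rewrite in_itv.
have : measurable_fun setT (fun v : 'rV[R]_d => `|v|).
  by apply: continuous_measurable_rV => x; exact: norm_continuous.
by apply.
Qed.

Lemma lebesgue_rV_mx_ball (a : R) : 0 <= a ->
  lebesgue_rV d [set v | `|v| <= a] = ((a *+ 2) ^+ d)%:E.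
Proof.
move=> a0; have := @lebesgue_rV_box R d (const_mx (- a)) (const_mx a).
move=> h; transitivity (\prod_(j < d)
  ((const_mx a : 'rV[R]_d) ord0 j - (const_mx (- a) : 'rV[R]_d) ord0 j))%:E.
  rewrite -h => [|j]; last by rewrite !mxE ge0_cp.
  congr (lebesgue_rV d _); apply/seteqP; split=> v /=.
    by move=> /(mx_norm_coord_le _ a0) va j; rewrite !mxE.
  by move=> va; apply/(mx_norm_coord_le _ a0) => j; have := va j; rewrite !mxE.
congr _%:E; rewrite (eq_bigr (fun=> a *+ 2)).
  by rewrite prodr_const card_ord.
by move=> j _; rewrite !mxE opprK mulr2n.
Qed.

(** The ball lies in a sup-norm ball, so its volume is finite and the [fine] in [unit_ball_volume]
    loses nothing. *)
Lemma unit_ball_volumeE :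
  lebesgue_rV d (norm_ball N 0 1) = (unit_ball_volume N)%:E.
Proof.
have [c c0 cN] := is_norm_ge_mx_norm N_norm.
rewrite /unit_ball_volume fineK// ge0_fin_numE//.
apply: (@le_lt_trans _ _ (lebesgue_rV d [set v | `|v| <= c^-1])).
  apply: le_measure; rewrite ?inE;
    [exact: measurable_norm_ball|exact: measurable_mx_ball|].
  move=> v; rewrite /norm_ball/= sub0r is_normN// => Nv.
  by rewrite -[leRHS]mulr1 ler_pdivlMl// (le_trans (cN _)).
by rewrite lebesgue_rV_mx_ball ?invr_ge0 ?ltW// ltry.
Qed.

Lemma unit_ball_volume_gt0 : 0 < unit_ball_volume N.
Proof.
have [C C0 NC] := is_norm_le_mx_norm N_norm.
rewrite -lte_fin -unit_ball_volumeE.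
apply: (@lt_le_trans _ _ (lebesgue_rV d [set v | `|v| <= C^-1])).
  rewrite lebesgue_rV_mx_ball ?invr_ge0 ?(ltW C0)// lte_fin exprn_gt0//.
  by rewrite pmulrn_lgt0// invr_gt0.
apply: le_measure; rewrite ?inE;
  [exact: measurable_mx_ball|exact: measurable_norm_ball|].
move=> v; rewrite /norm_ball/= sub0r is_normN// => vC.
by rewrite (le_trans (NC _))// -ler_pdivlMl// mulr1.
Qed.

Lemma lebesgue_rV_norm_ball x r : 0 < r ->
  lebesgue_rV d (norm_ball N x r) = (unit_ball_volume N * r ^+ d)%:E.
Proof.
move=> r0; rewrite (lebesgue_rV_affine x r0); last exact: measurable_norm_ball.
rewrite mulrC EFinM -unit_ball_volumeE; congr (_ * lebesgue_rV d _)%E.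
apply/seteqP; split=> v; rewrite /norm_ball/=
  opprD addrA subrr !sub0r !is_normN//;
  by rewrite (is_norm_homogeneous N_norm) gtr0_norm// ger_pMr.
Qed.

End ball_volume.

(** * Support and local density *)

Section support.
Context {R : realType} {d : nat} (N : 'rV[R]_d -> R).
Hypothesis N_norm : is_norm N.

Lemma rat_rV_dense (z : 'rV[R]_d) (e : R) : 0 < e ->
  exists c : 'rV[rat]_d, N (z - \row_j ratr (c ord0 j)) <= e.
Proof.
move=> e0; have [C C0 NC] := is_norm_le_mx_norm N_norm.
have eC0 : 0 < e / C by exact: divr_gt0.
have /choice[c cP] : forall j : 'I_d, exists c : rat,
    z ord0 j < ratr c < z ord0 j + e / C.
  move=> j; have [|c] := @rat_in_itvoo R (z ord0 j) (z ord0 j + e / C).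
    by rewrite ltrDl.
  by rewrite in_itv/= => h; exists c.
exists (\row_j c j); rewrite (le_trans (NC _))// -ler_pdivlMl// mulrC.
apply/(mx_norm_coord_le _ (ltW eC0)) => j; rewrite !mxE in_itv/=.
have /andP[h1 h2] := cP j.
by apply/andP; split; lra.
Qed.

(** Every point off [U] is the centre of a null ball, inside which lies a null ball with rational
    centre and radius that still contains the point; there are countably many of those. *)
Lemma measure_support_complement0 (mu : {measure set 'rV[R]_d -> \bar R})
  (U : set 'rV[R]_d) :
  measurable U -> measure_support N mu `<=` U -> mu (~` U) = 0.
Proof.
move=> mU sU; apply/negligibleP; first exact: measurableC.
pose B (cr : 'rV[rat]_d * rat) :=
  norm_ball N (\row_j ratr (cr.1 ord0 j)) (ratr cr.2).
pose F n := if unpickle n is Some cr then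
  (if `[< mu (B cr) = 0 >] then B cr else set0) else set0.
apply: (@negligibleS _ _ _ _ (\bigcup_n F n)); last first.
  apply: negligible_bigcup => n; rewrite /F.
  case: unpickle => [cr|]; last exact: negligible_set0.
  case: asboolP => [B0|_]; last exact: negligible_set0.
  by apply/negligibleP => //; exact: measurable_norm_ball.
move=> z /= Uz.
have [r r0 mur] : exists2 r : R, 0 < r & mu (norm_ball N z r) = 0.
  apply: contra_notP Uz => h; apply: sU => r r0.
  rewrite lt_neqAle measure_ge0 andbT eq_sym; apply/eqP => h0.
  by apply: h; exists r.
(* With [s < r / 2] and a rational centre within [s] of [z], the ball of radius [s] contains [z] and
   stays inside the ball of radius [r] around [z]. *)
have [s] := @rat_in_itvoo R 0 (r / 2) (divr_gt0 r0 (ltr0n _ 2)).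
rewrite in_itv/= => /andP[s0 sr].
have [c zc] := rat_rV_dense z s0.
exists (pickle (c, s)) => //; rewrite /F pickleK asboolT.
  by rewrite /B /norm_ball/= is_norm_subC.
apply/eqP; rewrite eq_le measure_ge0 andbT -mur.
apply: le_measure; rewrite ?inE;
  [exact: measurable_norm_ball|exact: measurable_norm_ball|].
move=> w; rewrite /B /norm_ball/= => cw.
rewrite -[z](subrK (\row_j ratr (c ord0 j))) -addrA
  (le_trans (is_norm_triangle N_norm _ _))//.
by rewrite (splitr r) lerD// (le_trans _ (ltW sr)).
Qed.

End support.

Section density.
Context {R : realType} {d : nat} (N : 'rV[R]_d -> R).
Hypothesis N_norm : is_norm N.
Variables (nu : probability 'rV[R]_d R) (U : set 'rV[R]_d) (p : 'rV[R]_d -> R).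
Hypotheses (U_open : open U) (p_density : is_density (fun A => nu (A `&` U)) p)
  (p_cont : {within U, continuous p}).

Local Notation v := (unit_ball_volume N).

(** Openness and continuity refer to the sup-norm topology; the equivalence of norms turns the
    neighbourhood into a ball of [N]. *)
Lemma density_ball_near x e : U x -> 0 < e -> exists2 r0 : R, 0 < r0 &
  forall y, N (x - y) <= r0 -> U y /\ `|p x - p y| <= e.
Proof.
move=> Ux e0; have [c c0 cN] := is_norm_ge_mx_norm N_norm.
have px : {for x, continuous p}.
  by move: p_cont; rewrite continuous_open_subspace// => /(_ x); rewrite inE;
    exact.
have : nbhs x (U `&` [set y | `|p x - p y| <= e]).
  apply: filterI; first exact: open_nbhs_nbhs.
  by move/(@cvgrPdist_le _ _ _ _ (nbhs_filter x)) : px => /(_ _ e0).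
move=> /nbhs_ballP[t /= t0 tU].
exists (c * (t / 2)); first by rewrite mulr_gt0// divr_gt0.
move=> y Nxy; apply: tU; rewrite mx_norm_ball /ball_/=.
apply: (@le_lt_trans _ _ (t / 2));
  last by rewrite ltr_pdivrMr// ltr_pMr// ltr1n.
by rewrite -(ler_pM2l c0) (le_trans (cN _)).
Qed.

(** Integrate [p], which stays within [e] of [p x], over a ball of volume [v * r ^+ d]. *)
Lemma density_ball_bounds x e : U x -> 0 < e -> exists2 r0 : R, 0 < r0 &
  forall r, 0 < r -> r <= r0 ->
    (((p x - e) * v * r ^+ d)%:E <= nu (norm_ball N x r) <=
      ((p x + e) * v * r ^+ d)%:E)%E.
Proof.
move=> Ux e0; have [r0 r00 h] := density_ball_near Ux e0.
have [mp p0 pE] := p_density.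
exists r0 => // r rgt0 rr0.
have mB : measurable (norm_ball N x r) by exact: measurable_norm_ball.
have BU y : norm_ball N x r y -> U y /\ `|p x - p y| <= e.
  by move=> By; apply: h; exact: le_trans rr0.
have -> : nu (norm_ball N x r) =
  (\int[lebesgue_rV d]_(y in norm_ball N x r) (p y)%:E)%E.
  rewrite -pE//; congr (nu _); apply/seteqP; split=> [y By|y []//]; split=> //.
  by have [] := BU y By.
have mpB : measurable_fun (norm_ball N x r) (fun y => (p y)%:E).
  by apply/measurable_EFinP; exact: measurable_funTS.
have cE (k : R) : ((k * v * r ^+ d)%:E =
  \int[lebesgue_rV d]_(y in norm_ball N x r) k%:E)%E.
  rewrite integral_cst//.
  have E := lebesgue_rV_norm_ball N_norm x rgt0.
  by rewrite -mulrA EFinM -E.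
apply/andP; split; last first.
  rewrite cE; apply: ge0_le_integral => //.
  - by move=> y _; rewrite lee_fin.
  - move=> y /BU[_]; rewrite lee_fin ler_norml => /andP[h1 h2]; lra.
(* The comparison of integrals wants nonnegative integrands; for negative [p x - e] the lower bound
   is trivial. *)
have [pe|pe] := leP 0 (p x - e).
  rewrite cE; apply: ge0_le_integral => //.
  - move=> y /BU[_]; rewrite lee_fin ler_norml => /andP[h1 h2]; lra.
apply: (@le_trans _ _ 0%E); last by apply: integral_ge0 => y _; rewrite lee_fin.
by rewrite lee_fin -mulrA mulr_le0_ge0 ?(ltW pe)// mulr_ge0 ?exprn_ge0
  ?(ltW rgt0) ?ltW ?unit_ball_volume_gt0.
Qed.

End density.

(** * Stretched exponential integrals *)

Section gamma.
Context {R : realType}.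
Local Notation leb := (@lebesgue_measure R).

(** The inequality [z <= 1 + z <= exp z] at [z = b t / a], raised to the power [a]. *)
Lemma powR_le_expR (a b t : R) : 0 < a -> 0 < b -> 0 <= t ->
  t `^ a <= (a / b) `^ a * expR (b * t).
Proof.
move=> a0 b0 t0.
have -> : expR (b * t) = expR (b * t / a) `^ a.
  by rewrite -expRM divfK// gt_eqF.
rewrite -powRM ?expR_ge0 ?divr_ge0 ?(ltW a0) ?(ltW b0)//.
rewrite ge0_ler_powR ?nnegrE ?mulr_ge0 ?expR_ge0 ?invr_ge0 ?(ltW a0)
  ?(ltW b0)//.
rewrite -ler_pdivrMl ?divr_gt0//.
rewrite (le_trans _ (expR_ge1Dx _))// invf_div mulrAC -mulrA.
rewrite [leRHS]addrC; rewrite ler_wpDr//.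
Qed.

Lemma powR_inv_lt (s u y : R) : 0 < s -> 0 <= u -> 0 <= y ->
  (u `^ s^-1 < y) = (u < y `^ s).
Proof.
move=> s0 u0 y0.
have uE : u = (u `^ s^-1) `^ s by rewrite -powRrM mulVf ?gt_eqF// powRr1.
rewrite [in RHS]uE; apply/idP/idP.
  by move=> h; rewrite gt0_ltr_powR ?nnegrE ?powR_ge0.
apply: contraTT; rewrite -!leNgt.
by move=> h; rewrite ge0_ler_powR ?nnegrE ?powR_ge0 ?(ltW s0).
Qed.

Lemma integral_expR_tail (k a : R) : 0 < k ->
  (\int[leb]_(t in `[a, +oo[) (expR (- (k * t)))%:E =
    (expR (- (k * a)) / k)%:E)%E.
Proof.
move=> k0.
have cF : continuous (fun t : R => expR (- (k * t))).
  move=> t; apply: (continuous_comp (f := fun t : R => - (k * t)) (g := expR));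
    last exact: continuous_expR.
  by apply: continuousN; apply: continuousM;
    [exact: cst_continuous|exact: cvg_id].
rewrite (@ge0_continuous_FTC2y _ _ (fun t => - (expR (- (k * t)) / k)) _ 0)//.
- by rewrite EFinN oppeK add0e.
- exact: continuous_subspaceT.
- rewrite -[0]oppr0 -[in X in _ --> X](mul0r k^-1); apply: cvgN;
  apply: cvgMr_tmp.
  apply: (@cvg_comp _ _ _ (fun t => k * t) (fun z => expR (- z)) _
    (pinfty_nbhs R)); last exact: cvgr_expR.
  exact: gt0_cvgMry.
- by apply: cvgN; apply: cvgMr_tmp; apply/cvg_at_right_filter; exact: cF.
- move=> t _; rewrite derive1E; apply: derive_val.
  apply: is_derive_eq.
  rewrite scaler0 add0r /GRing.scale/= mulr1; field.
  by rewrite gt_eqF.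
Qed.


Lemma measurable_expRN (k : R) :
  measurable_fun [set: R] (fun t => expR (- (k * t))).
Proof.
apply: measurableT_comp => //; apply: measurableT_comp => //.
Qed.

(** [Gamma] is a real-valued integral, taken through [fine], so finiteness has to be shown: it
    follows from a bound of [t^s] by a multiple of [exp (t / 2)]. *)
Lemma Gamma_integral (s : R) : 0 < s ->
  (\int[leb]_(t in `]0%R, +oo[) (t `^ s * expR (- t))%:E =
    (Gamma (1 + s))%:E)%E.
Proof.
move=> s0; rewrite /Gamma /Rintegral [1 + s]addrC addrK fineK//.
have mf : measurable_fun [set: R] (fun t : R => t `^ s * expR (- t)).
  apply: measurable_funM; first exact: measurable_powR.
  by apply: measurableT_comp => //; exact: measurable_funN.
rewrite ge0_fin_numE; last first.
  by apply: integral_ge0 => t _; rewrite lee_fin mulr_ge0 ?powR_ge0 ?expR_ge0.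
have h0 : 0 < 2^-1 :> R by rewrite invr_gt0.
apply: (@le_lt_trans _ _ (\int[leb]_(t in `]0%R, +oo[)
    (((s / 2^-1) `^ s)%:E * (expR (- (2^-1 * t)))%:E))%E).
  apply: ge0_le_integral => //.
  - by move=> t _; rewrite lee_fin mulr_ge0 ?powR_ge0 ?expR_ge0.
  - by apply/measurable_EFinP; exact: measurable_funTS.
  - apply/measurable_EFinP; apply: measurable_funTS;
    apply: measurable_funM => //.
    exact: measurable_expRN.
  - move=> t; rewrite /= in_itv/= andbT => t0; rewrite -EFinM lee_fin.
    apply: (@le_trans _ _ ((s / 2^-1) `^ s * expR (2^-1 * t) * expR (- t))).
      by rewrite ler_wpM2r ?expR_ge0// powR_le_expR// ltW.
    rewrite -mulrA -expRD ler_wpM2l ?powR_ge0// ler_expR; lra.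
rewrite ge0_integralZl//; last 2 first.
- apply/measurable_EFinP; apply: measurable_funTS.
  exact: measurable_expRN.
- by rewrite lee_fin powR_ge0.
rewrite integral_itv_obnd_cbnd; last first.
  apply/measurable_EFinP; apply: measurable_funTS.
  exact: measurable_expRN.
by rewrite integral_expR_tail// -EFinM ltry.
Qed.

(** Write the exponential as the integral of [exp (- t)] over [t > c u^(1/s)] and exchange the
    integrals: for fixed [t] the values of [u] fill an interval of length [(t/c)^s], and the Gamma
    integral remains. *)
Lemma integral_expR_powR (s c : R) : 0 < s -> 0 < c ->
  (\int[leb]_(u in `[0%R, +oo[) (expR (- (c * u `^ s^-1)))%:E =
  (Gamma (1 + s) / c `^ s)%:E)%E.
Proof.
move=> s0 c0; pose GR := measurableTypeR R.
pose B : set (GR * GR) :=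
  [set z | [/\ 0 < z.1, 0 <= z.2 & c * z.2 `^ s^-1 < z.1]].
have mB : measurable B.
  pose b1 (z : GR * GR) := (0 < z.1).
  pose b2 (z : GR * GR) := (0 <= z.2).
  pose b3 (z : GR * GR) := (c * z.2 `^ s^-1 < z.1).
  have -> : B = (setT `&` b1 @^-1` [set true]) `&`
    ((setT `&` b2 @^-1` [set true]) `&` (setT `&` b3 @^-1` [set true])).
    rewrite !setTI; apply/seteqP; split => z /=; first by case.
    by case=> ? [].
  apply: measurableI; last apply: measurableI.
  - have : measurable_fun setT b1 by exact: measurable_fun_ltr.
    by apply.
  - have : measurable_fun setT b2 by exact: measurable_fun_ler.
    by apply.
  - have : measurable_fun setT b3.
      apply: measurable_fun_ltr => //; apply: measurable_funM => //.
      by apply: (measurableT_comp (measurable_powR _)).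
    by apply.
(* Tonelli for [exp (- t)] on the set [c u^(1/s) < t], i.e. [u < (t/c)^s]. *)
pose F (z : GR * GR) := ((expR (- z.1))%:E * (\1_B z)%:E)%E.
have mF : measurable_fun setT F.
  apply: emeasurable_funM; apply/measurable_EFinP; last exact: measurable_indic.
  by apply: measurableT_comp => //; exact: measurableT_comp.
have F0 z : (0 <= F z)%E by rewrite /F -EFinM lee_fin mulr_ge0 ?expR_ge0.
have lE : (\int[leb]_t \int[leb]_u F (t, u) = (Gamma (1 + s) / c `^ s)%:E)%E.
  transitivity (\int[leb]_(t in `]0%R, +oo[)
    ((c `^ s)^-1%:E * (t `^ s * expR (- t))%:E))%E; last first.
    rewrite ge0_integralZl//.
    - by rewrite Gamma_integral// -EFinM mulrC.
    - apply/measurable_EFinP; apply: measurable_funTS; apply: measurable_funM.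
        exact: measurable_powR.
      by apply: measurableT_comp.
    - by move=> t _; rewrite lee_fin mulr_ge0 ?powR_ge0 ?expR_ge0.
    - by rewrite lee_fin invr_ge0 powR_ge0.
  rewrite [RHS]integral_mkcond; apply: eq_integral => t _.
  rewrite patchE /F; have [t0|t0] := ltP 0 t; last first.
    rewrite memNset/= ?in_itv/= ?ltNge ?t0//.
    apply: integral0_eq => u _; rewrite indicE memNset ?mule0//.
    by rewrite /B/= => -[]; rewrite ltNge t0.
  rewrite mem_set/= ?in_itv/= ?t0//.
  have tcs : 0 <= (t / c) `^ s by exact: powR_ge0.
  under eq_integral => u _.
    rewrite (_ : \1_B (t, u) = \1_`[0, (t / c) `^ s[%classic u); last first.
      rewrite !indicE; congr (_%:R); congr nat_of_bool; apply/idP/idP;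
        rewrite !inE/= in_itv/=.
        move=> [_ u0]; rewrite mulrC -ltr_pdivlMr// powR_inv_lt// ?divr_ge0
          ?(ltW t0) ?(ltW c0)//.
        by rewrite u0.
      move=> /andP[u0 ut]; split => //.
      by rewrite mulrC -ltr_pdivlMr// powR_inv_lt// divr_ge0 ?(ltW t0)
        ?(ltW c0).
    over.
  rewrite ge0_integralZl//; last first.
    by apply/measurable_EFinP; exact: measurable_indic.
  rewrite integral_indic//= setIT.
  rewrite lebesgue_measure_itv/= lte_fin.
  rewrite powRM ?invr_ge0 ?(ltW t0) ?(ltW c0)//.
  have -> : c^-1 `^ s = (c `^ s)^-1.
    by rewrite -powRN -powR_inv1 ?(ltW c0)// -powRrM mulN1r.
  have tcs0 : 0 < t `^ s / c `^ s by rewrite divr_gt0 ?powR_gt0.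
  by rewrite tcs0 oppr0 adde0 -!EFinM; congr _%:E; ring.
rewrite -lE fubini_tonelli// [LHS]integral_mkcond; apply: eq_integral => u _.
rewrite patchE /F; have [u0|u0] := leP 0 u; last first.
  rewrite memNset/= ?in_itv/= ?leNgt ?u0//; apply/esym.
  apply: integral0_eq => t _; rewrite indicE memNset ?mule0//.
  by rewrite /B/= => -[_]; rewrite leNgt u0.
rewrite mem_set/= ?in_itv/= ?u0//.
have cu : 0 <= c * u `^ s^-1 by rewrite mulr_ge0 ?(ltW c0)// powR_ge0.
transitivity (\int[leb]_(t in `](c * u `^ s^-1)%R, +oo[)
  (expR (- (1 * t)))%:E)%E.
  rewrite integral_itv_obnd_cbnd.
    by rewrite integral_expR_tail// divr1 mul1r.
  by apply/measurable_EFinP; apply: measurable_funTS; exact: measurable_expRN.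
rewrite integral_mkcond; apply: eq_integral => t _; rewrite patchE mul1r.
have [tu|tu] := ltP (c * u `^ s^-1) t.
  rewrite mem_set/= ?in_itv/= ?tu// indicE mem_set ?mule1//.
  by split => //=; exact: le_lt_trans tu.
rewrite memNset/= ?in_itv/= ?ltNge ?tu// indicE memNset ?mule0//.
by rewrite /B/= => -[_ _]; rewrite ltNge tu.
Qed.

End gamma.

(** * Domination and pointwise convergence *)

Section tail_ball.
Context {R : realType} {d : nat} (N : 'rV[R]_d -> R).
Hypothesis N_norm : is_norm N.
Variable nu : probability 'rV[R]_d R.

Local Notation tail := (tail_ball N nu).

Lemma tail_ball_ge0 x r : 0 <= tail x r.
Proof. by rewrite -lee_fin tail_ballE. Qed.

Lemma norm_ball_tailE x r : nu (norm_ball N x r) = (1 - tail x r)%:E.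
Proof.
rewrite EFinB tail_ballE// -probability_setC ?setCK//.
by apply: measurableC; exact: measurable_norm_ball.
Qed.

Lemma tail_ball_le1 x r : tail x r <= 1.
Proof. by rewrite -subr_ge0 -lee_fin -norm_ball_tailE. Qed.

Lemma tail_ball_shift x y r t : N (x - y) + t <= r -> tail x r <= tail y t.
Proof.
move=> xyr; rewrite -lee_fin !tail_ballE//; apply: le_measure; rewrite ?inE.
- by apply: measurableC; exact: measurable_norm_ball.
- by apply: measurableC; exact: measurable_norm_ball.
- apply: subsetC => z; rewrite /norm_ball/= => yz.
  rewrite (le_trans _ xyr)//.
  have -> : x - z = (x - y) + (y - z) by rewrite addrA subrK.
  by rewrite (le_trans (is_norm_triangle N_norm _ _))// lerD2l.
Qed.

Lemma tail_ball_nonincreasing x r t : t <= r -> tail x r <= tail x t.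
Proof. by move=> tr; apply: tail_ball_shift;
  rewrite subrr is_norm0// add0r. Qed.

(** The tail is the measure of a section of a measurable subset of the product. *)
Lemma measurable_tail_ball d1 (T : measurableType d1) (x : T -> 'rV[R]_d)
  (r : T -> R) :
  measurable_fun setT x -> measurable_fun setT r ->
  measurable_fun setT (fun t => tail (x t) (r t)).
Proof.
move=> mx mr.
pose A := [set w : T * 'rV[R]_d | r w.1 < N (x w.1 - w.2)].
have mA : measurable A.
  pose b (w : T * 'rV[R]_d) := r w.1 < N (x w.1 - w.2).
  have -> : A = setT `&` b @^-1` [set true] by rewrite setTI.
  have : measurable_fun setT b.
    apply: measurable_fun_ltr;
      first exact: (measurableT_comp mr measurable_fst).
    apply: measurable_norm_sub => //;
      exact: (measurableT_comp mx measurable_fst).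
  by apply.
apply/measurable_EFinP.
have -> : EFin \o (fun t => tail (x t) (r t)) = nu \o xsection A.
  apply/funext => t /=; rewrite tail_ballE//; congr (nu _).
  apply/seteqP; split=> y; rewrite /xsection/= inE /A/= /norm_ball/=.
    by rewrite real_ltNge ?num_real// => /negP.
  by rewrite real_ltNge ?num_real// => /negP.
exact: measurable_fun_xsection.
Qed.

End tail_ball.

(** * Rescaled radii *)

Section radius.
Context {R : realType} (q : R) (d : nat).
Hypotheses (q0 : 0 < q) (d0 : (0 < d)%N).

(** Chosen so that, for a distance [D], with [m > 0] and [u >= 0], the condition [(m^(1/d) D)^q > u]
    amounts to [D > radius m u]. *)
Definition radius m (u : R) : R := u `^ q^-1 / m%:R `^ d%:R^-1.

Let d_neq0 : d%:R != 0 :> R. Proof. by rewrite pnatr_eq0 -lt0n. Qed.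

Lemma radius_exp m u : (0 < m)%N -> m%:R * radius m u ^+ d = u `^ (q / d%:R)^-1.
Proof.
move=> m0; have mR0 : (0 : R) < m%:R by rewrite ltr0n.
rewrite /radius exprMn exprVn -![_ ^+ d]powR_mulrn ?powR_ge0// -!powRrM.
rewrite mulVf// powRr1 ?ler0n// mulrCA divff ?gt_eqF// mulr1.
by rewrite invf_div mulrC.
Qed.

Lemma radiusK m u : (0 < m)%N -> 0 <= u ->
  (radius m u * m%:R `^ d%:R^-1) `^ q = u.
Proof.
move=> m0 u0; rewrite /radius divfK; last by rewrite gt_eqF// powR_gt0// ltr0n.
by rewrite -powRrM mulVf ?gt_eqF// powRr1.
Qed.

Lemma radius_gt0 m u : (0 < m)%N -> 0 < u -> 0 < radius m u.
Proof. by move=> m0 u0; rewrite divr_gt0// powR_gt0// ltr0n. Qed.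

Lemma radius_near u r0 : 0 < r0 -> \forall m \near \oo, radius m u <= r0.
Proof.
move=> r00; near=> m.
have m0 : (0 < m)%N by near: m; exact: nbhs_infty_gt.
rewrite /radius ler_pdivrMr ?powR_gt0 ?ltr0n// mulrC -ler_pdivrMr//.
set b := _ / r0; have b0 : 0 <= b by rewrite divr_ge0 ?powR_ge0// ltW.
(* The condition on [m] now reads [b <= m^(1/d)], which holds once [m >= b^d]. *)
have bE : b = (b `^ d%:R) `^ d%:R^-1 by rewrite -powRrM divff// powRr1.
rewrite [leLHS]bE ge0_ler_powR ?nnegrE ?powR_ge0 ?ler0n ?invr_ge0 ?ler0n//.
near: m; exact: nbhs_infty_ger.
Unshelve. all: by end_near. Qed.

End radius.

Section domination.
Context {R : realType} {d : nat} (N : 'rV[R]_d -> R).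
Hypotheses (d0 : (0 < d)%N) (N_norm : is_norm N).
Variable nu : probability 'rV[R]_d R.
Variable q : R.
Hypothesis q0 : 0 < q.

Local Notation tail := (tail_ball N nu).
Local Notation s := (q / d%:R).
Local Notation rm := (radius q d).

Let dR0 : (0 : R) < d%:R. Proof. by rewrite ltr0n. Qed.
Let s0 : 0 < s. Proof. exact: divr_gt0. Qed.

(** Shrinking the radius by the factor [rk / A] brings it below [rk], where the lower bound on balls
    holds. Then [1 - z <= exp (- z)] applies, and by [radius_exp] the exponent is free of [m]. *)
Lemma tail_near_le (a rk A : R) x (m : nat) (u : R) : (0 < m)%N -> 0 < u ->
    0 < rk -> 0 <= a -> rk <= A ->
    (forall r, 0 <= r <= rk -> ((a * r ^+ d)%:E <= nu (norm_ball N x r))%E) ->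
    rm m u <= A ->
  tail x (rm m u) ^+ m <= expR (- (a * (rk / A) ^+ d * u `^ s^-1)).
Proof.
move=> m0 u0 rk0 a0 rkA hB rA; set r := rm m u.
have r0 : 0 < r by exact: radius_gt0.
have A0 : 0 < A by exact: lt_le_trans rkA.
pose t := r * (rk / A).
have t0 : 0 < t by rewrite mulr_gt0// divr_gt0.
have trk : t <= rk.
  by rewrite /t mulrCA ger_pMr// ler_pdivrMr// mul1r.
have tr : t <= r by rewrite /t ger_pMr// ler_pdivrMr// mul1r.
have h : tail x r <= expR (- (a * t ^+ d)).
  rewrite (le_trans (tail_ball_nonincreasing N_norm nu x tr))//.
  have := hB t; rewrite (ltW t0) trk => /(_ isT).
  rewrite (norm_ball_tailE N_norm) lee_fin lerBrDr -lerBrDl => /le_trans; apply.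
  by rewrite (le_trans _ (expR_ge1Dx _)).
apply: (@le_trans _ _ (expR (- (a * t ^+ d)) ^+ m)).
  by rewrite lerXn2r ?nnegrE ?tail_ball_ge0 ?expR_ge0.
rewrite -expRM_natl ler_expR mulrN lerN2 /t [(r * _) ^+ d]exprMn.
rewrite -(radius_exp q d0 u m0) -/r.
by rewrite le_eqVlt; apply/orP; left; apply/eqP; set b := (rk / A) ^+ d; ring.
Qed.

(** The ball around [x] contains the ball of radius [r / 2] around 0, whose tail to the power [m0]
    is at most [1 / y] with [y = r / (2 K)]. Raising to the power [m / m0] leaves enough decay in
    [y] to dominate [u^2] uniformly in [m]. *)
Lemma tail_far_le (K : R) (m0 m : nat) (u : R) (x : 'rV[R]_d) : (0 < m0)%N ->
    (0 < m)%N -> 0 < u -> 1 <= K ->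
    (forall r, 0 < r -> tail 0 r ^+ m0 * r <= K) ->
    2 * q * m0%:R <= m%:R ->
    N x *+ 2 <= rm m u -> 2 * K * expR 1 <= rm m u ->
  tail x (rm m u) ^+ m <=
    2 * ((2 * K) `^ (2 * q) * expR (2 * q) * (2 * s * m0%:R) `^ (2 * s)) /
      oneDsqr u.
Proof.
move=> m00 mgt0 u0 K1 hK m_large Nx rK; set r := rm m u.
have m0R : (0 : R) < m0%:R by rewrite ltr0n.
have mR : (0 : R) < m%:R by rewrite ltr0n.
have mR1 : (1 : R) <= m%:R by rewrite ler1n.
have K0 : 0 < K by exact: lt_le_trans K1.
have r0 : 0 < r by exact: radius_gt0.
have e1 : 1 <= expR 1 :> R by rewrite -[leLHS]expR0 ler_expR.
pose y := r / (2 * K).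
have y0 : 0 < y by rewrite divr_gt0// mulr_gt0.
have ye : expR 1 <= y by rewrite ler_pdivlMr ?mulr_gt0// mulrC.
have ht : tail x r <= tail 0 (r / 2).
  apply: tail_ball_shift => //; rewrite subr0 [leRHS](splitr r) lerD2r.
  by rewrite ler_pdivlMr// mulr_natr.
have hy : tail x r ^+ m0 <= y^-1.
  apply: (@le_trans _ _ (tail 0 (r / 2) ^+ m0)).
    by rewrite lerXn2r ?nnegrE ?tail_ball_ge0.
  rewrite /y invf_div ler_pdivlMr// -ler_pdivrMl//.
  by rewrite mulrC -mulrA hK// divr_gt0.
have htm : tail x r ^+ m <= y `^ (- (m%:R / m0%:R)).
  have -> : tail x r ^+ m = (tail x r ^+ m0) `^ (m%:R / m0%:R).
    rewrite -[tail x r ^+ m]powR_mulrn ?tail_ball_ge0//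
      -[tail x r ^+ m0]powR_mulrn ?tail_ball_ge0// -powRrM; congr (_ `^ _).
    by rewrite mulrCA divff ?gt_eqF// mulr1.
  have -> : y `^ (- (m%:R / m0%:R)) = (y^-1) `^ (m%:R / m0%:R).
    by rewrite -[y^-1]powR_inv1 ?(ltW y0)// -powRrM mulN1r.
  by rewrite ge0_ler_powR ?nnegrE ?exprn_ge0 ?tail_ball_ge0 ?invr_ge0
    ?(ltW y0)//.
(* Since [y >= e], the part of the exponent beyond [2 q] contributes
   [exp (- k)], which absorbs the factor [m^(2 s)] hidden in [u ^ 2]. *)
pose k := m%:R / m0%:R - 2 * q.
have k0 : 0 <= k by rewrite subr_ge0 ler_pdivlMr.
have hk : y `^ (- (m%:R / m0%:R)) <= y `^ (- (2 * q)) * expR (- k).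
  have -> : - (m%:R / m0%:R) = - (2 * q) + - k by rewrite /k; ring.
  rewrite powRD; last by rewrite (gt_eqF y0) implybT.
  rewrite ler_wpM2l ?powR_ge0// powRN expRN lef_pV2 ?posrE ?powR_gt0
    ?expR_gt0//.
  by rewrite -[in leLHS](mul1r k) expRM ge0_ler_powR ?nnegrE ?expR_ge0
    ?(ltW y0).
have uE : u = (r * m%:R `^ d%:R^-1) `^ q by rewrite radiusK// ltW.
have rE : r = y * (2 * K) by rewrite /y divfK// gt_eqF// mulr_gt0.
clearbody y.
have one a : 1 = 1 `^ a :> R by rewrite powR1.
(* This bounds [1 + u^2] by [2 u^2], the source of the leading factor 2. *)
have u1 : 1 <= u.
  rewrite uE [leLHS](one q) ge0_ler_powR ?nnegrE ?mulr_ge0 ?powR_ge0 ?(ltW r0)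
    ?(ltW q0)//.
  rewrite -[leLHS]mulr1 ler_pM//.
    rewrite (le_trans _ rK)// -[leLHS]mulr1 ler_pM//; lra.
  by rewrite [leLHS](one d%:R^-1) ge0_ler_powR ?nnegrE ?invr_ge0 ?(ltW dR0).
have u2 : u ^+ 2 = y `^ (2 * q) * (2 * K) `^ (2 * q) * m%:R `^ (2 * s).
  rewrite [in LHS]uE -powR_mulrn ?powR_ge0// -powRrM.
  rewrite rE.
  rewrite powRM ?mulr_ge0 ?powR_ge0 ?(ltW y0) ?(ltW K0)//.
  rewrite powRM ?mulr_ge0 ?powR_ge0 ?(ltW y0) ?(ltW K0)//.
  rewrite -[(_ `^ d%:R^-1) `^ _]powRrM [q * _]mulrC; congr (_ * _ `^ _).
  by rewrite mulrCA [_ * q]mulrC.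
have D0 : 0 < oneDsqr u by apply: lt_le_trans (oneDsqr_ge1 u).
rewrite ler_pdivlMr//.
apply: (@le_trans _ _ (y `^ (- (2 * q)) * expR (- k) * (2 * u ^+ 2))).
  apply: ler_pM; rewrite ?exprn_ge0 ?tail_ball_ge0 ?(ltW D0) ?(le_trans htm)//.
  by rewrite /oneDsqr mulr_natl mulr2n lerD2r exprn_ege1.
rewrite u2.
have -> : y `^ (- (2 * q)) * expR (- k) *
  (2 * (y `^ (2 * q) * (2 * K) `^ (2 * q) * m%:R `^ (2 * s))) =
  2 * ((2 * K) `^ (2 * q) * (expR (- k) * m%:R `^ (2 * s))) *
    (y `^ (- (2 * q)) * y `^ (2 * q)) by ring.
rewrite -powRD; last by rewrite (gt_eqF y0) implybT.
rewrite addNr powRr0 mulr1 ler_pM2l// -mulrA ler_wpM2l ?powR_ge0//.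
have -> : - k = 2 * q + - (m%:R / m0%:R) by rewrite /k; ring.
rewrite expRD -mulrA ler_wpM2l ?expR_ge0//.
(* [m^(2 s) <= (2 s m0)^(2 s) exp (m / m0)]: once [exp (2 q)] is taken out of [exp (- k)], the rest
   cancels this growth in [m]. *)
have := @powR_le_expR R (2 * s) m0%:R^-1 m%:R (mulr_gt0 (ltr0n _ 2) s0) _
  (ltW mR).
rewrite invr_gt0 invrK => /(_ m0R) h.
rewrite -ler_pdivlMl ?expR_gt0// -expRN opprK [leRHS]mulrC [m%:R / _]mulrC.
exact: h.
Qed.

End domination.

Section pointwise.
Context {R : realType}.

Lemma cvg_onem_pow (g : R^nat) (a : R) : (forall m, 0 <= g m <= 1) ->
  m%:R * g m @[m --> \oo] --> a -> (1 - g m) ^+ m @[m --> \oo] --> expR (- a).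
Proof.
move=> g01 ga.
have g0 : g m @[m --> \oo] --> 0.
  have : (m%:R)^-1 * (m%:R * g m) @[m --> \oo] --> 0 * a.
    by apply: cvgM => //; apply/gtr0_cvgV0;
      [near=> m; rewrite ltr0n; near: m; exact: nbhs_infty_gt|exact: cvgr_idn].
  rewrite mul0r; apply: cvg_trans; apply: near_eq_cvg; near=> m.
  by rewrite mulrA mulVf ?mul1r// pnatr_eq0 -lt0n; near: m;
    exact: nbhs_infty_gt.
have h1 : expR (- (m%:R * g m / (1 - g m))) @[m --> \oo] --> expR (- a).
  apply: continuous_cvg; first exact: continuous_expR.
  apply: cvgN; rewrite -[X in _ --> X]divr1; apply: cvgM => //.
  apply: cvgV => //.
  by rewrite -[X in _ --> X]subr0; apply: cvgB => //; exact: cvg_cst.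
have h2 : expR (- (m%:R * g m)) @[m --> \oo] --> expR (- a).
  apply: continuous_cvg; first exact: continuous_expR.
  exact: cvgN.
(* [exp (- g / (1 - g)) <= 1 - g <= exp (- g)] *)
apply: (squeeze_cvgr _ h1 h2); near=> m.
have /andP[gm0 gm1] := g01 m.
have glt1 : g m < 1.
  by near: m; apply: (cvgr_lt _ g0); exact: ltr01.
have og0 : 0 < 1 - g m by rewrite subr_gt0.
apply/andP; split.
  rewrite -mulrA -mulrN expRM_natl lerXn2r ?nnegrE ?expR_ge0 ?(ltW og0)//.
  rewrite expRN -[leRHS]invrK lef_pV2 ?posrE ?invr_gt0 ?expR_gt0//.
  rewrite (le_trans _ (expR_ge1Dx _))//.
  have -> : 1 + g m / (1 - g m) = (1 - g m)^-1 by field; rewrite gt_eqF.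
  exact: lexx.
rewrite -mulrN expRM_natl lerXn2r ?nnegrE ?expR_ge0 ?(ltW og0)//.
exact: expR_ge1Dx.
Unshelve. all: by end_near. Qed.

Context {d : nat} (N : 'rV[R]_d -> R).
Hypotheses (d0 : (0 < d)%N) (N_norm : is_norm N).
Variables (nu : probability 'rV[R]_d R) (U : set 'rV[R]_d) (p : 'rV[R]_d -> R).
Hypotheses (U_open : open U) (p_density : is_density (fun A => nu (A `&` U)) p)
  (p_cont : {within U, continuous p}).
Variable q : R.
Hypothesis q0 : 0 < q.

(** By [radius_exp], [m] times the volume of the ball is constant, so [m] times its mass tends to
    [p x] times that constant, and [cvg_onem_pow] applies. *)
Lemma tail_pow_cvg x u : U x -> 0 < u ->
  tail_ball N nu x (radius q d m u) ^+ m @[m --> \oo] -->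
  expR (- (p x * unit_ball_volume N * u `^ (q / d%:R)^-1)).
Proof.
move=> Ux u0; set v := unit_ball_volume N; set a := u `^ _.
have v0 : 0 < v by exact: unit_ball_volume_gt0.
have a0 : 0 < a by exact: powR_gt0.
pose g m := 1 - tail_ball N nu x (radius q d m u).
have -> : (fun m => tail_ball N nu x (radius q d m u) ^+ m) =
  (fun m => (1 - g m) ^+ m).
  by apply/funext => m; rewrite /g opprB addrC subrK.
apply: cvg_onem_pow.
  move=> m; rewrite /g subr_ge0 tail_ball_le1//= lerBlDr lerDl.
  exact: tail_ball_ge0.
apply/cvgrPdist_le => e e0.
(* This tolerance on the density becomes [e] after multiplication by [v * a]. *)
have e'0 : 0 < e / (v * a) by rewrite divr_gt0// mulr_gt0.
have [r0 r00 h] := density_ball_bounds N_norm U_open p_density p_cont Ux e'0.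
near=> m.
have m0 : (0 < m)%N by near: m; exact: nbhs_infty_gt.
have mR : (0 : R) < m%:R by rewrite ltr0n.
have rle : radius q d m u <= r0 by near: m; exact: radius_near.
have := h _ (radius_gt0 q d m0 u0) rle.
rewrite (norm_ball_tailE N_norm) -/(g m) !lee_fin -/v => /andP[h1 h2].
have aE : a = m%:R * radius q d m u ^+ d by rewrite radius_exp.
have eE : e / (v * a) * (v * a) = e by rewrite divfK// gt_eqF// mulr_gt0.
have := ler_wpM2l (ltW mR) h1; have := ler_wpM2l (ltW mR) h2.
have -> : m%:R * ((p x + e / (v * a)) * v * radius q d m u ^+ d) =
  p x * v * a + e.
  by rewrite -[in RHS]eE aE; ring.
have -> : m%:R * ((p x - e / (v * a)) * v * radius q d m u ^+ d) =
  p x * v * a - e.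
  by rewrite -[in RHS]eE aE; ring.
by rewrite ler_norml => ? ?; apply/andP; split; lra.
Unshelve. all: by end_near. Qed.

End pointwise.

(** * Dominated convergence *)

Section half_line_product.
Context {R : realType} {d1 : measure_display} {T1 : measurableType d1}.
Variable mu : {sigma_finite_measure set T1 -> \bar R}.
Local Notation GR := (measurableTypeR R).
Local Notation leb := (@lebesgue_measure R).
Local Open Scope ereal_scope.

Definition half_line : set (T1 * GR) := setT `*` `]0%R, +oo[.

Lemma measurable_half_line : measurable half_line.
Proof. exact: measurableX. Qed.

Lemma half_lineE x (u : R) :
  ((x, u) \in half_line) = (u \in `]0%R, +oo[%classic).
Proof. by apply/idP/idP; rewrite !inE /half_line/=; [case|split]. Qed.

Section nonneg.
Variable f : T1 * GR -> \bar R.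
Hypotheses (mf : measurable_fun setT f) (f0 : forall z, 0 <= f z).

Let mfD : measurable_fun setT (f \_ half_line).
Proof.
have mH := measurable_half_line.
have := measurable_funTS (D := half_line) mf.
by move=> /(measurable_restrictT _ mH).
Qed.

Let f0D z : 0 <= (f \_ half_line) z.
Proof. by rewrite patchE; case: ifP. Qed.

Let patch_half_line x : (fun u : GR => (f \_ half_line) (x, u)) =
  ((fun u : GR => f (x, u)) \_ (`]0%R, +oo[%classic : set R)).
Proof. by apply/funext => u; rewrite !patchE half_lineE. Qed.

Lemma half_line_fubini1 : \int[mu \x leb]_(z in half_line) f z =
  \int[mu]_x \int[leb]_(u in `]0%R, +oo[) f (x, u).
Proof.
rewrite integral_mkcond fubini_tonelli1//; apply: eq_integral => x _.
by rewrite /fubini_F [RHS]integral_mkcond -patch_half_line.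
Qed.

Lemma measurable_half_line_fubini1 :
  measurable_fun setT (fun x => \int[leb]_(u in `]0%R, +oo[) f (x, u)).
Proof.
have := @measurable_fun_fubini_tonelli_F _ _ _ _ _ leb _ mfD f0D.
congr (measurable_fun _ _); apply/funext => x.
by rewrite /fubini_F [RHS]integral_mkcond -patch_half_line.
Qed.

Lemma half_line_fubini2 : \int[mu \x leb]_(z in half_line) f z =
  \int[leb]_(u in `]0%R, +oo[) \int[mu]_x f (x, u).
Proof.
rewrite integral_mkcond fubini_tonelli2// [RHS]integral_mkcond.
apply: eq_integral => u _; rewrite /fubini_G patchE.
have [u0|u0] := boolP (u \in _).
  by apply: eq_integral => x _; rewrite patchE half_lineE u0.
by apply: integral0_eq => x _; rewrite patchE half_lineE (negbTE u0).
Qed.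

End nonneg.

Lemma ae_half_line (U : set T1) (Q : T1 * GR -> Prop) : measurable U ->
  mu (~` U) = 0 -> (forall x u, U x -> (0 < u)%R -> Q (x, u)) ->
  {ae (mu \x leb), forall z, half_line z -> Q z}.
Proof.
move=> mU U0 UQ; exists (~` U `*` setT); split.
- by apply: measurableX => //; exact: measurableC.
- rewrite product_measure1E//; last exact: measurableC.
  by rewrite [X in X * _]U0 mul0e.
- move=> [x u] /= h; split => // Ux; apply: h => -[_ /=].
  by rewrite in_itv/= andbT => u0; exact: UQ.
Qed.

End half_line_product.

Section limit.
Context {R : realType} {d : nat} (N : 'rV[R]_d -> R).
Hypotheses (d0 : (0 < d)%N) (N_norm : is_norm N).
Variables (mu nu : probability 'rV[R]_d R) (U : set 'rV[R]_d)
  (p : 'rV[R]_d -> R).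
Hypotheses (U_open : open U) (muU : mu (~` U) = 0)
  (p_density : is_density (fun A => nu (A `&` U)) p)
  (p_cont : {within U, continuous p}) (p_gt0 : forall x, U x -> 0 < p x).
Variable q : R.
Hypothesis q0 : 0 < q.
Variables (kappa rk K : R) (m0 : nat).
Hypotheses (kappa0 : 0 < kappa) (rk0 : 0 < rk) (m00 : (0 < m0)%N) (K1 : 1 <= K).
Hypothesis p_ball : forall x, U x -> forall r, 0 <= r <= rk ->
  ((kappa * p x * unit_ball_volume N * r ^+ d)%:E <= nu (norm_ball N x r))%E.
Hypothesis tailK : forall r, 0 < r -> tail_ball N nu 0 r ^+ m0 * r <= K.
Hypothesis moment :
  (\int[mu]_x ((1 + N x `^ q) / p x `^ (q / d%:R))%:E < +oo)%E.

Local Notation GR := (measurableTypeR R).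
Local Notation leb := (@lebesgue_measure R).
Local Notation v := (unit_ball_volume N).
Local Notation s := (q / d%:R).
Local Notation tail := (tail_ball N nu).
Local Notation half := (half_line (T1 := 'rV[R]_d) (R := R)).

Let s0 : 0 < s. Proof. by rewrite divr_gt0// ltr0n. Qed.
Let v0 : 0 < v. Proof. exact: unit_ball_volume_gt0. Qed.
Let p_ge0 x : 0 <= p x. Proof. by case: p_density. Qed.
Let mp : measurable_fun setT p. Proof. by case: p_density. Qed.
Let mN : measurable_fun setT N. Proof. exact: measurable_is_norm. Qed.

(** A radius above [A x] exceeds both [2 |x|] and [2 K e], as the far bound requires, and the term
    [rk] yields [rk <= A x] for the near bound. [c x] and [C3] are the constants coming from these
    two bounds. *)
Let A x := N x *+ 2 + (rk + 2 * K * expR 1).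
Let c x := kappa * p x * v * (rk / A x) ^+ d.
Let C3 := 2 * ((2 * K) `^ (2 * q) * expR (2 * q) * (2 * s * m0%:R) `^ (2 * s)).
Let f m (z : 'rV[R]_d * GR) := tail z.1 (radius q d m z.2) ^+ m.
Let finf (z : 'rV[R]_d * GR) := expR (- (p z.1 * v * z.2 `^ s^-1)).
Let g1 (z : 'rV[R]_d * GR) := expR (- (c z.1 * z.2 `^ s^-1)).
Let g2 (z : 'rV[R]_d * GR) := C3 / oneDsqr z.2.
Let g z := g1 z + g2 z.

Let K0 : 0 < K. Proof. exact: lt_le_trans K1. Qed.

Let rkA x : rk <= A x.
Proof.
rewrite /A addrCA lerDl addr_ge0 ?mulrn_wge0 ?is_norm_ge0//.
by rewrite !mulr_ge0 ?expR_ge0// ltW.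
Qed.

Let A0 x : 0 < A x. Proof. exact: lt_le_trans (rkA x). Qed.

Let C30 : 0 <= C3.
Proof. by rewrite /C3 !mulr_ge0 ?powR_ge0 ?expR_ge0. Qed.

Let g20 z : 0 <= g2 z.
Proof. by rewrite /g2 divr_ge0// (le_trans _ (oneDsqr_ge1 _)). Qed.

Let c_ge0 x : 0 <= c x.
Proof. by rewrite /c !mulr_ge0 ?exprn_ge0 ?divr_ge0// ltW. Qed.

Let measurable_stretched (h : 'rV[R]_d -> R) : measurable_fun setT h ->
  measurable_fun setT (fun z : 'rV[R]_d * GR => expR (- (h z.1 * z.2 `^ s^-1))).
Proof.
move=> mh; apply: measurableT_comp => //; apply: measurableT_comp => //.
apply: measurable_funM; first exact: (measurableT_comp mh measurable_fst).
exact: (measurableT_comp (measurable_powR _) measurable_snd).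
Qed.

Let mA : measurable_fun setT A.
Proof.
apply: measurable_funD => //.
under eq_fun do rewrite mulr2n.
exact: measurable_funD.
Qed.

Let mc : measurable_fun setT c.
Proof.
apply: measurable_funM.
  by apply: measurable_funM => //; exact: measurable_funM.
apply: measurable_funX; apply: measurable_funM => //.
under eq_fun do rewrite -powR_inv1 ?(ltW (A0 _))//.
exact: (measurableT_comp (measurable_powR _) mA).
Qed.

Let mf m : measurable_fun setT (f m).
Proof.
apply: measurable_funX; apply: measurable_tail_ball => //.
apply: measurable_funM => //.
exact: (measurableT_comp (measurable_powR _) measurable_snd).
Qed.

Let mfinf : measurable_fun setT finf.
Proof.
have mpv : measurable_fun setT (fun x => p x * v) by exact: measurable_funM.
exact: (measurable_stretched mpv).
Qed.

Let mg1 : measurable_fun setT g1.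
Proof. exact: (measurable_stretched mc). Qed.

Let mg2 : measurable_fun setT g2.
Proof.
apply: measurable_funM => //.
have mo : measurable_fun [set: R] (fun u : R => (oneDsqr u)^-1).
  by apply: continuous_measurable_fun; exact: continuous_oneDsqrV.
exact: (measurableT_comp mo measurable_snd).
Qed.

Let integral_g2 : (\int[leb]_(u in `]0%R, +oo[) (C3 / oneDsqr u)%:E =
  (C3 * (pi / 2))%:E)%E.
Proof.
have mo : measurable_fun [set: R] (fun u : R => (oneDsqr u)^-1).
  by apply: continuous_measurable_fun; exact: continuous_oneDsqrV.
have moE : measurable_fun (`]0, +oo[%classic : set R)
  (fun u : R => ((oneDsqr u)^-1)%:E).
  by apply/measurable_EFinP; exact: measurable_funTS.
under eq_integral do rewrite EFinM.
rewrite ge0_integralZl//.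
by rewrite integral_itv_obnd_cbnd// integral0y_oneDsqr -EFinM.
Qed.

Let measurable_stretched1 a : measurable_fun (`]0, +oo[%classic : set R)
  (fun u => (expR (- (a * u `^ s^-1)))%:E).
Proof.
apply/measurable_EFinP; apply: measurable_funTS.
apply: measurableT_comp => //; apply: measurableT_comp => //.
by apply: measurable_funM => //; exact: measurable_powR.
Qed.

Let measurable_oneDsqrV : measurable_fun (`]0, +oo[%classic : set R)
  (fun u => (C3 / oneDsqr u)%:E).
Proof.
apply/measurable_EFinP; apply: measurable_funTS; apply: measurable_funM => //.
by apply: continuous_measurable_fun; exact: continuous_oneDsqrV.
Qed.

Let integral_stretched a : 0 < a ->
  (\int[leb]_(u in `]0%R, +oo[) (expR (- (a * u `^ s^-1)))%:E =
  (Gamma (1 + s) / a `^ s)%:E)%E.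
Proof.
move=> a0; rewrite -integral_expR_powR// integral_itv_obnd_cbnd//.
Qed.

Let C4 := Gamma (1 + s) / ((kappa * v) `^ s * rk `^ q) *
  ((2 + (rk + 2 * K * expR 1)) `^ q * 2 `^ q).

(** Since [d s = q], the left-hand side is a constant times [A(x)^q / p(x)^s], and [A(x)] is affine
    in [|x|]. This reduces the integral of the near bound to the moment hypothesis. *)
Let c_integral_le x : U x ->
  Gamma (1 + s) / c x `^ s <= C4 * ((1 + N x `^ q) / p x `^ s).
Proof.
move=> Ux; have px := p_gt0 Ux.
have kv0 : 0 < kappa * v by exact: mulr_gt0.
have -> : c x `^ s = (kappa * v) `^ s * p x `^ s * (rk `^ q / A x `^ q).
  have -> : c x = (kappa * v) * p x * (rk / A x) ^+ d.
    by rewrite /c; set b := _ ^+ d; ring.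
  rewrite powRM ?mulr_ge0 ?exprn_ge0 ?divr_ge0 ?(ltW kappa0) ?(ltW v0) ?(ltW px)
    ?(ltW rk0) ?(ltW (A0 x))//.
  rewrite powRM ?(ltW kv0) ?(ltW px)//; congr (_ * _).
  rewrite -powR_mulrn ?divr_ge0 ?(ltW rk0) ?(ltW (A0 x))// -powRrM.
  rewrite mulrCA divff ?mulr1 ?pnatr_eq0 -?lt0n//.
  rewrite powRM ?invr_ge0 ?(ltW rk0) ?(ltW (A0 x))//; congr (_ * _).
  by rewrite -[X in X `^ q = _]powR_inv1 ?(ltW (A0 x))// -powRrM mulN1r powRN.
have kvs : 0 < (kappa * v) `^ s by exact: powR_gt0.
have ps : 0 < p x `^ s by exact: powR_gt0.
have rks : 0 < rk `^ q by exact: powR_gt0.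
have As : 0 < A x `^ q by exact: powR_gt0.
have G0 : 0 <= Gamma (1 + s).
  by apply: Rintegral_ge0 => t _; rewrite mulr_ge0 ?powR_ge0 ?expR_ge0.
rewrite [leLHS](_ : _ = Gamma (1 + s) / ((kappa * v) `^ s * rk `^ q) *
  (A x `^ q / p x `^ s)); last first.
  by rewrite !invfM invrK; ring.
rewrite /C4 -!mulrA ler_wpM2l// ler_wpM2l ?invr_ge0 ?mulr_ge0 ?powR_ge0//.
rewrite !mulrA ler_wpM2r ?invr_ge0 ?powR_ge0//.
set B := _ + _ * expR 1.
have B0 : 0 < B by rewrite addr_gt0// !mulr_gt0 ?expR_gt0.
have AE : A x = N x *+ 2 + B by [].
have Nx := is_norm_ge0 N_norm x.
clearbody B; rewrite AE; apply: (@le_trans _ _ (((2 + B) * (1 + N x)) `^ q)).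
  rewrite ge0_ler_powR ?nnegrE ?mulr_ge0 ?addr_ge0 ?mulrn_wge0 ?(ltW q0)
    ?(ltW B0)//.
  rewrite -subr_ge0.
  have -> : (2 + B) * (1 + N x) - (N x *+ 2 + B) = 2 + B * N x by ring.
  by rewrite addr_ge0// mulr_ge0// ltW.
rewrite powRM ?addr_ge0 ?(ltW B0)// -mulrA ler_wpM2l ?powR_ge0//.
(* [(1 + |x|)^q <= 2^q max(1, |x|)^q <= 2^q (1 + |x|^q)], whence the factor [2^q] in [C4]. *)
apply: (@le_trans _ _ ((2 * Num.max 1 (N x)) `^ q)).
  rewrite ge0_ler_powR ?nnegrE ?addr_ge0 ?mulr_ge0 ?le_max ?ler01 ?(ltW q0)//.
  by rewrite mulr_natl mulr2n lerD// le_max lexx ?orbT.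
rewrite powRM ?le_max ?ler01// ler_wpM2l ?powR_ge0//.
rewrite maxEle; case: ifPn => _; first by rewrite lerDr.
by rewrite powR1 lerDl powR_ge0.
Qed.

Let mU : measurable U. Proof. exact: open_measurable_rV. Qed.

Let ae_U (Q : 'rV[R]_d -> Prop) : (forall x, U x -> Q x) ->
  {ae mu, forall x, Q x}.
Proof.
move=> UQ; exists (~` U); split => //; first exact: measurableC.
by apply: subsetC => x /UQ.
Qed.

Let g1_ge0 z : 0 <= g1 z. Proof. exact: expR_ge0. Qed.

(** Integrating first in [u], for [x] in [U], [g1] contributes at most [C4] times the integrand of
    [moment], and [g2] a constant, which the probability [mu] integrates. *)
Let integrable_g : (mu \x leb)%E.-integrable half (EFin \o g).
Proof.
have mhalf := @measurable_half_line R _ 'rV[R]_d.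
have mg : measurable_fun setT g by exact: measurable_funD.
apply/integrableP; split.
  by apply/measurable_EFinP; exact: measurable_funTS.
rewrite (eq_integral (fun z => (g z)%:E)) => [|z _]; last first.
  by rewrite /= ger0_norm// addr_ge0.
have mgE : measurable_fun setT (fun z => (g z)%:E) by exact/measurable_EFinP.
have gE0 z : (0 <= (g z)%:E)%E by rewrite lee_fin addr_ge0.
rewrite half_line_fubini1//.
have mh : measurable_fun setT (fun x => (1 + N x `^ q) / p x `^ s).
  apply: measurable_funM.
    by apply: measurable_funD => //;
      exact: (measurableT_comp (measurable_powR _) mN).
  under eq_fun do rewrite -powRN.
  exact: (measurableT_comp (measurable_powR _) mp).
have h0 x : 0 <= (1 + N x `^ q) / p x `^ s.
  by rewrite divr_ge0 ?addr_ge0 ?powR_ge0.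
have pi0 : 0 <= C3 * (pi / 2) by rewrite mulr_ge0// divr_ge0// pi_ge0.
have C40 : 0 <= C4.
  rewrite /C4 !mulr_ge0 ?invr_ge0 ?mulr_ge0 ?powR_ge0//.
  by apply: Rintegral_ge0 => t _; rewrite mulr_ge0 ?powR_ge0 ?expR_ge0.
apply: (@le_lt_trans _ _ (\int[mu]_x
  (C4%:E * ((1 + N x `^ q) / p x `^ s)%:E + (C3 * (pi / 2))%:E))%E).
  apply: ae_ge0_le_integral => //.
  - by move=> x _; apply: integral_ge0 => u _.
  - exact: (measurable_half_line_fubini1 mgE gE0).
  - move=> x _; rewrite -EFinM -EFinD lee_fin addr_ge0//.
    by rewrite mulr_ge0.
  - apply: emeasurable_funD => //; apply: emeasurable_funM => //.
    exact/measurable_EFinP.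
  - apply: ae_U => x Ux _.
    have cx : 0 < c x.
      by rewrite /c mulr_gt0 ?exprn_gt0 ?divr_gt0// !mulr_gt0// p_gt0.
    rewrite [leLHS](_ : _ = \int[leb]_(u in `]0%R, +oo[)
        ((expR (- (c x * u `^ s^-1)))%:E + (C3 / oneDsqr u)%:E))%E; last first.
      by apply: eq_integral => u _; rewrite -EFinD.
    rewrite ge0_integralD//=.
    + rewrite integral_stretched// integral_g2 -EFinM leeD2r// lee_fin.
      exact: c_integral_le.
    + exact: measurable_stretched1.
    + by move=> u _; rewrite lee_fin (g20 (x, u)).
rewrite ge0_integralD//=.
- rewrite ge0_integralZl//.
  + rewrite integral_cst// lte_add_pinfty// ?lte_mul_pinfty//.
    by rewrite ltey_eq fin_num_measure.
  + exact/measurable_EFinP.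
  + by move=> x _; rewrite lee_fin.
- by move=> x _; rewrite -EFinM lee_fin mulr_ge0.
- by apply: emeasurable_funM => //; exact/measurable_EFinP.
Qed.

Lemma nn_integral_cvg :
  (\int[leb]_(u in `]0%R, +oo[) \int[mu]_x (tail x (radius q d m u) ^+ m)%:E)%E
    @[m --> \oo] -->
  ((Gamma (1 + s) / v `^ s)%:E * \int[mu]_x ((p x `^ s)^-1)%:E)%E.
Proof.
have mhalf := @measurable_half_line R _ 'rV[R]_d.
have -> : ((Gamma (1 + s) / v `^ s)%:E * \int[mu]_x ((p x `^ s)^-1)%:E =
    \int[mu \x leb]_(z in half) (finf z)%:E)%E.
  have mfE : measurable_fun setT (fun z => (finf z)%:E) by
    exact/measurable_EFinP.
  have fE0 z : (0 <= (finf z)%:E)%E by rewrite lee_fin expR_ge0.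
  have mps : measurable_fun setT (fun x => (p x `^ s)^-1).
    under eq_fun do rewrite -powRN.
    exact: (measurableT_comp (measurable_powR _) mp).
  have Gv0 : 0 <= Gamma (1 + s) / v `^ s.
    rewrite divr_ge0 ?powR_ge0//.
    by apply: Rintegral_ge0 => t _; rewrite mulr_ge0 ?powR_ge0 ?expR_ge0.
  rewrite half_line_fubini1// -ge0_integralZl//; last 2 first.
  - exact/measurable_EFinP.
  - by move=> x _; rewrite lee_fin invr_ge0 powR_ge0.
  apply: ge0_ae_eq_integral => //.
  - by apply: emeasurable_funM => //; exact/measurable_EFinP.
  - exact: (measurable_half_line_fubini1 mfE fE0).
  - by move=> x _; rewrite -EFinM lee_fin mulr_ge0// invr_ge0 powR_ge0.
  - by move=> x _; apply: integral_ge0.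
  (* Positivity of [p] is available on [U] only, which carries [mu]. *)
  - apply: ae_U => x Ux _; rewrite /finf/= integral_stretched; last first.
      by rewrite mulr_gt0// p_gt0.
    rewrite -EFinM powRM// ?(ltW v0)// invfM; congr _%:E; ring.
have -> : (fun m => \int[leb]_(u in `]0%R, +oo[) \int[mu]_x
  (tail x (radius q d m u) ^+ m)%:E)%E =
   (fun m => \int[mu \x leb]_(z in half) (f m z)%:E)%E.
  apply/funext => m; rewrite half_line_fubini2//.
    by apply/measurable_EFinP; exact: mf.
  by move=> z; rewrite lee_fin exprn_ge0// tail_ball_ge0.
(* From the index [M0] on, [m] is positive and at least [2 q m0], as the far bound requires;
   shifting the sequence keeps its limit. *)
pose M0 := (Num.truncn (2 * q * m0%:R)).+1.
rewrite -(cvg_shiftn M0).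
have [|||||_ _] := @dominated_convergence _ _ R (mu \x leb)%E half mhalf
  (fun m z => (f (m + M0)%N z)%:E) (EFin \o finf) (EFin \o g).
- move=> m; apply/measurable_EFinP; exact: measurable_funTS.
- apply/measurable_EFinP; exact: measurable_funTS.
- apply: (ae_half_line mU muU) => x u Ux u0.
  apply/fine_cvgP; split; first by apply: nearW.
  rewrite (cvg_shiftn M0 (fun m => f m (x, u))).
  exact: (tail_pow_cvg d0 N_norm U_open p_density p_cont).
- exact: integrable_g.
- suff h : {ae (mu \x leb)%E, forall z, half z -> forall m,
      (`|(f (m + M0)%N z)%:E| <= (g z)%:E)%E}.
    by move: h; apply: filterS => z h m /h.
  apply: (ae_half_line mU muU) => x u Ux u0 m.
  have fge0 : 0 <= f (m + M0)%N (x, u) by rewrite exprn_ge0// tail_ball_ge0.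
  rewrite gee0_abs ?lee_fin//.
  have mM0 : (0 < m + M0)%N by rewrite addn_gt0 orbT.
  (* Each regime uses one summand of [g]: [g1] up to the radius [A x], [g2] beyond it. *)
  have [rA|rA] := leP (radius q d (m + M0) u) (A x).
    rewrite /g -[leLHS]addr0 lerD//.
    apply: tail_near_le rA => //.
      by rewrite !mulr_ge0// ltW.
    exact: p_ball.
  rewrite /g -[leLHS]add0r lerD//.
  apply: (tail_far_le d0 N_norm q0 m00) => //.
  - by rewrite (le_trans (ltW (truncnS_gt _)))// ler_nat leq_addl.
  - rewrite (le_trans _ (ltW rA))// /A lerDl addr_ge0 ?(ltW rk0)//.
    by rewrite !mulr_ge0 ?expR_ge0// ltW.
  - rewrite (le_trans _ (ltW rA))// /A addrA lerDr addr_ge0 ?(ltW rk0)//.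
    by rewrite mulrn_wge0// is_norm_ge0.
by [].
Qed.

End limit.

(** * Expected cost as a layer-cake integral *)

Section expected_distance.
Context {R : realType} {d : nat} (N : 'rV[R]_d -> R).
Hypothesis N_norm : is_norm N.
Context {disp : measure_display} {T : measurableType disp}.
Variables (P : probability T R) (muX muX' : probability 'rV[R]_d R).
Variables (X X' : nat -> {RV P >-> 'rV[R]_d}).
Hypothesis XX' : two_iid_samples muX muX' X X'.
Variable q : R.
Hypothesis q0 : 0 < q.

Local Notation leb := (@lebesgue_measure R).
Local Notation tail := (tail_ball N muX').

Lemma measurable_sample_dist m (x : T -> 'rV[R]_d) : (0 < m)%N ->
  measurable_fun setT x ->
  measurable_fun setT (fun w => nn_dist N m (X' ^~ w) (x w)).
Proof.
move=> m0 mx.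
by apply: (@measurable_nn_dist _ _ _ N_norm _ _ m (fun j => X' j : T -> _) x).
Qed.

(** Markov's inequality for the minimum of the first [m0] norms, whose tail is [tail 0 r ^+ m0].
    Adding 1 to the expectation secures [1 <= K]. *)
Lemma tail_moment_le m0 : (0 < m0)%N ->
  (\int[P]_w (\big[Num.min/N (X' 0%N w)]_(j < m0) N (X' j w))%:E < +oo)%E ->
  exists2 K : R, 1 <= K & forall r, 0 < r -> tail 0 r ^+ m0 * r <= K.
Proof.
move=> m00; set M := (X in (X < _)%E) => Mfin.
have ME : M = (\int[P]_w (nn_dist N m0 (X' ^~ w) 0)%:E)%E.
  apply: eq_integral => w _; rewrite /nn_dist sub0r is_normN//.
  by under [in RHS]eq_bigr do rewrite sub0r is_normN//.
have M0 : (0 <= M)%E.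
  by rewrite ME; apply: integral_ge0 => w _; rewrite lee_fin nn_dist_ge0.
have mD : measurable_fun setT (fun w => (nn_dist N m0 (X' ^~ w) 0)%:E).
  by apply/measurable_EFinP; exact: measurable_sample_dist.
exists (fine M + 1); first by rewrite lerDr fine_ge0.
move=> r r0; apply: (@le_trans _ _ (fine M)); last by rewrite lerDl.
pose A := [set w | r < nn_dist N m0 (X' ^~ w) 0].
have mA : measurable A.
  have -> : A = setT `&` (fun w => nn_dist N m0 (X' ^~ w) 0) @^-1` `]r, +oo[.
    by rewrite setTI; apply/seteqP; split => w /=; rewrite in_itv/= andbT.
  exact: measurable_sample_dist.
rewrite -lee_fin fineK ?ge0_fin_numE// mulrC EFinM -(nn_dist_tail N_norm XX')//.
rewrite -integral_cst// ME.
apply: (@le_trans _ _ (\int[P]_(w in A) (nn_dist N m0 (X' ^~ w) 0)%:E)%E).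
  apply: ge0_le_integral => //.
  - by move=> w _; rewrite lee_fin ltW.
  - exact: measurable_funTS.
  - by move=> w; rewrite /A/= lee_fin => /ltW.
apply: ge0_subset_integral => //.
by move=> w _; rewrite lee_fin nn_dist_ge0.
Qed.

(** Layer-cake formula for [Z], the [q]-th power of the rescaled distance: the event [u < Z] says
    that the distance exceeds [radius q d m u], and [nn_dist_law] gives its probability. *)
Lemma expected_nn_dist i m : (0 < m)%N ->
  ((m%:R `^ (q / d%:R))%:E *
   \int[P]_w (nn_dist N m (X' ^~ w) (X i w) `^ q)%:E =
   \int[leb]_(u in `]0%R, +oo[) \int[muX]_x
     (tail x (radius q d m u) ^+ m)%:E)%E.
Proof.
move=> m0; have mR : (0 : R) < m%:R by rewrite ltr0n.
have md0 : 0 < m%:R `^ d%:R^-1 :> R by exact: powR_gt0.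
pose Z w := (m%:R `^ d%:R^-1 * nn_dist N m (X' ^~ w) (X i w)) `^ q.
have mD : measurable_fun setT (fun w => nn_dist N m (X' ^~ w) (X i w)).
  exact: measurable_sample_dist.
have mZ : measurable_fun setT Z.
  by apply: (measurableT_comp (measurable_powR _)); exact: measurable_funM.
pose Y : {RV P >-> R} := HB.pack Z (isMeasurableFun.Build _ _ _ _ _ mZ).
transitivity (\int[P]_w (Y w)%:E)%E.
  rewrite -ge0_integralZl//; last 2 first.
  - apply/measurable_EFinP; exact: (measurableT_comp (measurable_powR _) mD).
  - by move=> w _; rewrite lee_fin powR_ge0.
  apply: eq_integral => w _; rewrite -EFinM; congr _%:E.
  rewrite /= /Z powRM ?nn_dist_ge0 ?(ltW md0)// -powRrM.
  by rewrite [q / _]mulrC.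
rewrite -expectation_def ge0_expectation_ccdf; last by move=> w;
  exact: powR_ge0.
rewrite -integral_itv_obnd_cbnd; last first.
  by apply: measurable_funTS; exact: ccdf_measurable.
apply: eq_integral => u; rewrite inE/= in_itv/= andbT => u0.
rewrite -(nn_dist_law N_norm XX' i _ m0) /ccdf/= /distribution /pushforward.
congr (P _); apply/seteqP; split=> w /=; rewrite in_itv/= andbT /Z;
  rewrite -powR_inv_lt ?(ltW u0) ?mulr_ge0 ?nn_dist_ge0 ?(ltW md0)//;
  by rewrite /radius ltr_pdivrMr// mulrC.
Qed.

(** The [n] terms of the average cost have the same expectation, so the factor [1/n] cancels and the
    value does not depend on [n]. *)
Lemma expected_wasserstein n m : 1 <= q -> (0 < n)%N -> (0 < m)%N ->
  ((m%:R `^ (q / d%:R))%:E *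
     \int[P]_w (wasserstein N q
        (empirical n (fun i => X i w))
        (nn_empirical N n m (fun i => X i w) (fun j => X' j w)) `^ q) =
   \int[leb]_(u in `]0%R, +oo[) \int[muX]_x
     (tail x (radius q d m u) ^+ m)%:E)%E.
Proof.
move=> q1 n0 m0.
under eq_integral do rewrite (wasserstein_nn N_norm)//.
have mD (i : 'I_n) : measurable_fun setT
  (fun w => (nn_dist N m (X' ^~ w) (X i w) `^ q)%:E).
  apply/measurable_EFinP; apply: (measurableT_comp (measurable_powR _)).
  exact: measurable_sample_dist.
have D0 (i : 'I_n) w : (0 <= (nn_dist N m (X' ^~ w) (X i w) `^ q)%:E)%E.
  by rewrite lee_fin powR_ge0.
rewrite ge0_integralZl//; last 2 first.
- exact: (emeasurable_sum _ mD).
- by move=> w _; apply: sume_ge0.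
rewrite (ge0_integral_sum _ _ mD)//.
rewrite muleCA ge0_sume_distrr; last by move=> i _; exact: integral_ge0.
under eq_bigr do rewrite expected_nn_dist// -[integral _ _ _]mul1e.
rewrite -ge0_sume_distrl// sumEFin sumr_const card_ord.
by rewrite muleA -EFinM mulVf ?mul1e// pnatr_eq0 -lt0n.
Qed.

End expected_distance.

Theorem theorem3p8 (R : realType) (d : nat) (d_gt0 : (0 < d)%N)
  (N : 'rV[R]_d -> R) (N_norm : is_norm N)
  (disp : measure_display) (T : measurableType disp) (P : probability T R)
  (muX muX' : probability 'rV[R]_d R)
  (X X' : nat -> {RV P >-> 'rV[R]_d})
  (samples : two_iid_samples muX muX' X X')
  (q : R) (q_ge1 : 1 <= q)
  (ha : exists2 m0 : nat, (0 < m0)%N &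
     (\int[P]_w (\big[Num.min/N (X' 0%N w)]_(j < m0) N (X' j w))%:E < +oo)%E)
  (U : set 'rV[R]_d) (U_open : open U) (supp_U : measure_support N muX `<=` U)
  (p : 'rV[R]_d -> R)
  (p_density : is_density (fun A => muX' (A `&` U)) p)
  (p_cont : {within U, continuous p})
  (p_gt0 : forall x, U x -> 0 < p x)
  (p_ball : exists kappa r_kappa : R, [/\ 0 < kappa <= 1, 0 < r_kappa &
     forall x, U x -> forall r, 0 <= r <= r_kappa ->
       ((kappa * p x * unit_ball_volume N * r ^+ d)%:E
          <= muX' (norm_ball N x r))%E])
  (hc : (\int[muX]_x ((1 + N x `^ q) / p x `^ (q / d%:R))%:E < +oo)%E) :
  forall n : nat, (0 < n)%N ->
    ((m%:R `^ (q / d%:R))%:E *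
       \int[P]_w (wasserstein N q
          (empirical n (fun i => X i w))
          (nn_empirical N n m (fun i => X i w) (fun j => X' j w)) `^ q))%E
      @[m --> \oo] -->
    ((Gamma (1 + q / d%:R) / unit_ball_volume N `^ (q / d%:R))%:E *
       \int[muX]_x ((p x `^ (q / d%:R))^-1)%:E)%E.
Proof.
move=> n n0; have q0 : 0 < q by exact: lt_le_trans q_ge1.
have [m0 m00 Mfin] := ha.
have [K K1 tailK] := tail_moment_le N_norm samples m00 Mfin.
have [kappa [rk [/andP[kappa0 _] rk0 hball]]] := p_ball.
have muU : muX (~` U) = 0.
  by apply: (measure_support_complement0 N_norm) => //;
    exact: open_measurable_rV.
have := nn_integral_cvg d_gt0 N_norm U_open muU p_density p_cont p_gt0 q0
  kappa0 rk0 m00 K1 hball tailK hc.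
(* The integral formula holds for [m > 0], which is enough for the limit. *)
apply: cvg_trans; apply: near_eq_cvg; near=> m.
rewrite (expected_wasserstein N_norm samples)//.
by near: m; exact: nbhs_infty_gt.
Unshelve. all: by end_near. Qed.
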